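(* Let $\mathcal{C}$ be a class of finite groups closed under subgroups, quotients and extensions. Let $(\iota_1,\iota_2)$ be a commensuration between pro-$\mathcal{C}$ groups $G_1$ and $G_2$ over a pro-$\mathcal{C}$ group $H$, and let $G=G_1\amalg_H G_2$ be the associated free pro-$\mathcal{C}$ amalgamated product. Denote by $H_G$ the normal core of $H$ in $G$. Then $(\iota_1,\iota_2)$ admits a completion (in the category of pro-$\mathcal{C}$ groups) if and only if both of the following hold: (i) $G$ is a proper amalgamated product of $G_1$ and $G_2$; (ii) the image of $G$ in $\operatorname{Out} H_G$ is finite.
   Context: A pro-$\mathcal{C}$ group is an inverse limit of finite groups in $\mathcal{C}$ (with its profinite topology). A commensuration between pro-$\mathcal{C}$ groups $G_1,G_2$ over a pro-$\mathcal{C}$ group $H$ is a pair $(\iota_1,\iota_2)$ of continuous monomorphisms $\iota_i:H\to G_i$ with open images, $i=1,2$. A completion of $(\iota_1,\iota_2)$ is a pair $(j_1,j_2)$ of continuous monomorphisms $j_i:G_i\to K$ with open images into a common pro-$\mathcal{C}$ group $K$ such that $j_1\circ\iota_1=j_2\circ\iota_2$. The free pro-$\mathcal{C}$ amalgamated product $G_1\amalg_H G_2$ is the pushout of $\iota_1,\iota_2$ in the category of pro-$\mathcal{C}$ groups and continuous homomorphisms; it comes with natural maps $\varphi_i:G_i\to G_1\amalg_H G_2$, and is called proper if $\varphi_1$ and $\varphi_2$ are both injective. When $G$ is proper, $H,G_1,G_2$ are identified with their images in $G$. The normal core of $H$ in $G$ is $H_G=\bigcap_{g\in G}H^g$. $\operatorname{Out}$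 denotes the group of continuous automorphisms modulo inner automorphisms, and the map $G\to\operatorname{Out}H_G$ is induced by conjugation. *)

(* Defs.v *)
From HB Require Import structures.
From mathcomp Require Import all_boot all_fingroup.
From mathcomp Require Import boolp classical_sets functions cardinality.
From mathcomp Require Import topology.

Set Implicit Arguments.
Unset Strict Implicit.
Unset Printing Implicit Defensive.

Local Open Scope quotient_scope.
Local Open Scope classical_set_scope.
Local Open Scope group_scope.

HB.mixin Record isTopologicalGroup G of monoid.Group G & Topological G := {
  mulg_continuous : continuous (fun x : G * G => x.1 * x.2);
  invg_continuous : continuous (fun x : G => x^-1)
}.

#[short(type="topologicalGroupType")]
HB.structure Definition TopologicalGroup :=
  {G of monoid.Group G & Topological G & isTopologicalGroup G}.

#[short(type="continuousMorphismType")]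
HB.structure Definition ContinuousMorphism (G H : topologicalGroupType) :=
  {f of @UMagmaMorphism G H f & @Continuous G H f}.

Notation "{ 'continuous_morphism' G -> H }" :=
  (continuousMorphismType G%type H%type)
  (G at level 98, H at level 99,
   format "{ 'continuous_morphism'  G  ->  H }") : type_scope.

(* Subgroups and quotients are taken up to isomorphism, so that such a class is
   in particular closed under isomorphism. *)
Record closed_class (C : finGroupType -> Prop) : Prop := {
  closed_sub : forall (A B : finGroupType) (f : UMagmaMorphism.type A B),
    injective f -> C B -> C A;
  closed_quotient : forall (A B : finGroupType) (f : UMagmaMorphism.type A B),
    range f = [set: B] -> C A -> C B;
  closed_extension : forall (N E Q : finGroupType)
      (i : UMagmaMorphism.type N E) (q : UMagmaMorphism.type E Q),
    injective i -> range q = [set: Q] -> range i = [set x | q x = 1] ->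
    C N -> C Q -> C E
}.

(* bond i j is only meaningful when i <= j. *)
Record inverse_system := InverseSystem {
  idx : Type;
  idx_le : idx -> idx -> Prop;
  idx_refl : forall i, idx_le i i;
  idx_anti : forall i j, idx_le i j -> idx_le j i -> i = j;
  idx_trans : forall i j k, idx_le i j -> idx_le j k -> idx_le i k;
  idx_nonempty : exists i : idx, True;
  idx_directed : forall i j, exists k, idx_le i k /\ idx_le j k;
  term : idx -> finGroupType;
  bond : forall i j, UMagmaMorphism.type (term j) (term i);
  bond_id : forall i x, bond i i x = x;
  bond_comp : forall i j k, idx_le i j -> idx_le j k ->
    forall x, bond i j (bond j k x) = bond i k x
}.

Definition to_product (S : inverse_system) (G : Type)
    (p : forall i : idx S, G -> term i) (g : G) :
    prod_topology (fun i => discrete_topology (term i)) :=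
  fun i => p i g.

(* p identifies the topological group G with the closed subgroup of compatible
   families in the product of the discrete groups term i. *)
Record is_inverse_limit (S : inverse_system) (G : topologicalGroupType)
    (p : forall i : idx S, UMagmaMorphism.type G (term i)) : Prop := {
  limit_inj : injective (to_product p);
  limit_range : range (to_product p) =
    [set x | forall i j, idx_le i j -> bond i j (x j) = x i];
  limit_open : forall U : set G,
    open U <-> exists2 B, open B & to_product p @^-1` B = U
}.

Definition pro (C : finGroupType -> Prop) (G : topologicalGroupType) : Prop :=
  exists2 S : inverse_system, (forall i : idx S, C (term i)) &
    exists p : forall i : idx S, UMagmaMorphism.type G (term i),
      is_inverse_limit p.

Definition open_mono (G H : topologicalGroupType)
    (f : {continuous_morphism G -> H}) : Prop :=
  injective f /\ open (range f).

Definition commensuration (H G1 G2 : topologicalGroupType)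
    (i1 : {continuous_morphism H -> G1}) (i2 : {continuous_morphism H -> G2}) :
    Prop :=
  open_mono i1 /\ open_mono i2.

Definition completion (H G1 G2 K : topologicalGroupType)
    (i1 : {continuous_morphism H -> G1}) (i2 : {continuous_morphism H -> G2})
    (j1 : {continuous_morphism G1 -> K}) (j2 : {continuous_morphism G2 -> K}) :
    Prop :=
  [/\ open_mono j1, open_mono j2 & j1 \o i1 =1 j2 \o i2].

Definition has_completion (C : finGroupType -> Prop)
    (H G1 G2 : topologicalGroupType)
    (i1 : {continuous_morphism H -> G1}) (i2 : {continuous_morphism H -> G2}) :
    Prop :=
  exists2 K : topologicalGroupType, pro C K &
    exists (j1 : {continuous_morphism G1 -> K})
           (j2 : {continuous_morphism G2 -> K}), completion i1 i2 j1 j2.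

(* The free pro-C amalgamated product of i1 and i2, i.e. their pushout in the
   category of pro-C groups; it is unique up to a unique isomorphism. *)
Record amalgamated_product (C : finGroupType -> Prop)
    (H G1 G2 G : topologicalGroupType)
    (i1 : {continuous_morphism H -> G1}) (i2 : {continuous_morphism H -> G2})
    (phi1 : {continuous_morphism G1 -> G})
    (phi2 : {continuous_morphism G2 -> G}) : Prop := {
  amalgam_pro : pro C G;
  amalgam_comm : phi1 \o i1 =1 phi2 \o i2;
  amalgam_univ : forall (K : topologicalGroupType)
      (f1 : {continuous_morphism G1 -> K}) (f2 : {continuous_morphism G2 -> K}),
    pro C K -> f1 \o i1 =1 f2 \o i2 ->
    exists u : {continuous_morphism G -> K},
      [/\ u \o phi1 =1 f1, u \o phi2 =1 f2
        & forall v : {continuous_morphism G -> K},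
            v \o phi1 =1 f1 -> v \o phi2 =1 f2 -> v =1 u]
}.

Definition proper_amalgam (G1 G2 G : topologicalGroupType)
    (phi1 : {continuous_morphism G1 -> G})
    (phi2 : {continuous_morphism G2 -> G}) : Prop :=
  injective phi1 /\ injective phi2.

Record subgroup (G : groupType) := Subgroup {
  subgroup_set :> set G;
  subgroup1 : subgroup_set 1;
  subgroupM : forall x y,
    subgroup_set x -> subgroup_set y -> subgroup_set (x * y);
  subgroupV : forall x, subgroup_set x -> subgroup_set x^-1
}.

Section SubgroupGroup.
Variables (G : groupType) (A : subgroup G).
Implicit Types x y z : set_type A.

Let mk (g : G) (Ag : subgroup_set A g) : set_type A := exist _ g (mem_set Ag).
Let inA x : subgroup_set A (val x) := set_mem (valP x).

Let one : set_type A := mk (subgroup1 A).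
Let mul x y : set_type A := mk (subgroupM (inA x) (inA y)).
Let inv x : set_type A := mk (subgroupV (inA x)).

Let mulA : associative mul.
Proof. by move=> x y z; apply: val_inj; rewrite /= mulgA. Qed.
Let mul1 : left_id one mul.
Proof. by move=> x; apply: val_inj; rewrite /= mul1g. Qed.
Let mulr1 : right_id one mul.
Proof. by move=> x; apply: val_inj; rewrite /= mulg1. Qed.
Let mulV : left_inverse one inv mul.
Proof. by move=> x; apply: val_inj; rewrite /= mulVg. Qed.
Let mulrV : right_inverse one inv mul.
Proof. by move=> x; apply: val_inj; rewrite /= mulgV. Qed.

HB.instance Definition _ :=
  isGroup.Build (set_type A) mulA mul1 mulr1 mulV mulrV.

Lemma subgroup_valM x y : val (x * y) = val x * val y. Proof. by []. Qed.
Lemma subgroup_valV x : val x^-1 = (val x)^-1. Proof. by []. Qed.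

End SubgroupGroup.

Section SubgroupTopologicalGroup.
Variables (G : topologicalGroupType) (A : subgroup G).

Let val_cts : continuous (val : set_type A -> G).
Proof. exact: initial_continuous. Qed.

Let cts_val (T : topologicalType) (f : T -> set_type A) :
  continuous (val \o f) -> continuous f.
Proof.
by move=> /continuousP fc; apply/continuousP => _ [B oB <-]; exact: fc.
Qed.

Let mul_cts :
  continuous (fun x : set_type A * set_type A => x.1 * x.2).
Proof.
apply: cts_val => x.
have pc : (fun x : set_type A * set_type A => (val x.1, val x.2)) @ x -->
    (val x.1, val x.2).
  apply: (@cvg_pair _ _ _ _ (nbhs (val x.1)) (nbhs (val x.2))) => /=.
    by apply: (cvg_comp _ _ cvg_fst); exact: val_cts.
  by apply: (cvg_comp _ _ cvg_snd); exact: val_cts.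
exact: (cvg_comp _ _ pc (@mulg_continuous G (val x.1, val x.2))).
Qed.

Let inv_cts : continuous (fun x : set_type A => x^-1).
Proof.
apply: cts_val => x.
exact: (cvg_comp _ _ (@val_cts x) (@invg_continuous G (val x))).
Qed.

HB.instance Definition _ :=
  isTopologicalGroup.Build (set_type A) mul_cts inv_cts.

End SubgroupTopologicalGroup.

Section RangeSubgroup.
Variables (G H : groupType) (f : UMagmaMorphism.type G H).

Let range1 : range f 1. Proof. by exists 1; rewrite ?gmulf1. Qed.
Let rangeM x y : range f x -> range f y -> range f (x * y).
Proof. by move=> [a _ <-] [b _ <-]; exists (a * b); rewrite ?gmulfM. Qed.
Let rangeV x : range f x -> range f x^-1.
Proof. by move=> [a _ <-]; exists a^-1; rewrite ?gmulfV. Qed.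

Definition range_subgroup : subgroup H := Subgroup range1 rangeM rangeV.

End RangeSubgroup.

Section NormalCore.
Variables (G : groupType) (A : subgroup G).

Let core : set G := \bigcap_(g in [set: G]) [set a ^ g | a in A].

Let core1 : core 1.
Proof. by move=> g _; exists 1; [exact: subgroup1 | exact: conj1g]. Qed.
Let coreM x y : core x -> core y -> core (x * y).
Proof.
move=> cx cy g _; have [a Aa <-] := cx g I; have [b Ab <-] := cy g I.
by exists (a * b); [exact: subgroupM | exact: conjMg].
Qed.
Let coreV x : core x -> core x^-1.
Proof.
move=> cx g _; have [a Aa <-] := cx g I.
by exists a^-1; [exact: subgroupV | exact: conjVg].
Qed.

Definition normal_core : subgroup G := Subgroup core1 coreM coreV.

Lemma normal_coreJ x g :
  subgroup_set normal_core x -> subgroup_set normal_core (x ^ g).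
Proof.
move=> cx h _; have [a Aa ah] := cx (h * g^-1) I; exists a => //.
by rewrite -ah -conjgM mulgVK.
Qed.

End NormalCore.

(* The inverse is required to be continuous as well; this is automatic for
   compact Hausdorff groups, such as profinite groups. *)
Record continuous_aut (G : topologicalGroupType) := ContinuousAut {
  aut_fun :> {continuous_morphism G -> G};
  aut_inv : {continuous_morphism G -> G};
  aut_funK : cancel aut_fun aut_inv;
  aut_invK : cancel aut_inv aut_fun
}.

HB.instance Definition _ (G : topologicalGroupType) :=
  gen_eqMixin (continuous_aut G).
HB.instance Definition _ (G : topologicalGroupType) :=
  gen_choiceMixin (continuous_aut G).

Section Out.
Variable G : topologicalGroupType.
Implicit Types a b c : continuous_aut G.

Definition inner_rel a b : bool := `[< exists h, forall x, a x = b x ^ h >].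

Let inner_refl : reflexive inner_rel.
Proof. by move=> a; apply/asboolP; exists 1 => x; rewrite conjg1. Qed.
Let inner_sym : symmetric inner_rel.
Proof.
by move=> a b; apply/asboolP/asboolP => -[h ab]; exists h^-1 => x;
  rewrite ab conjgK.
Qed.
Let inner_trans : transitive inner_rel.
Proof.
move=> b a c /asboolP[h ab] /asboolP[k bc]; apply/asboolP.
by exists (k * h) => x; rewrite ab bc conjgM.
Qed.

Canonical inner_equiv := EquivRel inner_rel inner_refl inner_sym inner_trans.

(* The cosets of the inner automorphisms; the group structure they inherit from
   composition plays no role in the finiteness of a subset. *)
Definition Out : Type := {eq_quot inner_rel}.

Definition out_class a : Out := \pi_({eq_quot inner_rel}) a.

Lemma out_classP a b :
  out_class a = out_class b <-> exists h, forall x, a x = b x ^ h.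
Proof. by split=> [/eqquotP/asboolP | ab]; last exact/eqquotP/asboolP. Qed.

End Out.

Section ConjugationAction.
Variables (G : topologicalGroupType) (A : subgroup G).
Let N := normal_core A.

Definition conj_fun (g : G) (x : set_type N) : set_type N :=
  exist _ (val x ^ g) (mem_set (normal_coreJ g (set_mem (valP x)))).

Let conj_fun1 g : conj_fun g 1 = 1.
Proof. by apply: val_inj; rewrite /= conj1g. Qed.
Let conj_funM g : {morph conj_fun g : x y / x * y}.
Proof. by move=> x y; apply: val_inj; rewrite /= conjMg. Qed.
Let conj_fun_cts g : continuous (conj_fun g).
Proof.
have vc : continuous (val : set_type N -> G) by exact: initial_continuous.
have mc (f h : set_type N -> G) : continuous f -> continuous h ->
    continuous (fun x => f x * h x).
  move=> fc hc x.
  have pc : (fun x => (f x, h x)) @ x --> (f x, h x).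
    apply: (@cvg_pair _ _ _ _ (nbhs (f x)) (nbhs (h x))).
    - exact: nbhs_filter.
    - exact: fc.
    - exact: hc.
  exact: (cvg_comp _ _ pc (@mulg_continuous G (f x, h x))).
have cc (a : G) : continuous (fun _ : set_type N => a).
  exact: cst_continuous.
have /continuousP valJ : continuous (fun x : set_type N => val x ^ g).
  exact: (mc _ _ (cc _) (mc _ _ vc (cc _))).
by apply/continuousP => _ [B oB <-]; exact: valJ.
Qed.

HB.instance Definition _ g :=
  isMultiplicative.Build (set_type N) (set_type N) (conj_fun g) (@conj_funM g).
HB.instance Definition _ g :=
  Multiplicative_isUMagmaMorphism.Build (set_type N) (set_type N) (conj_fun g)
    (conj_fun1 g).
HB.instance Definition _ g :=
  isContinuous.Build (set_type N) (set_type N) (conj_fun g) (@conj_fun_cts g).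

Let conj_funK g : cancel (conj_fun g) (conj_fun g^-1).
Proof. by move=> x; apply: val_inj; rewrite /= conjgK. Qed.
Let conj_funVK g : cancel (conj_fun g^-1) (conj_fun g).
Proof. by move=> x; apply: val_inj; rewrite /= conjgKV. Qed.

Definition conj_aut (g : G) : continuous_aut (set_type N) :=
  @ContinuousAut (set_type N) (conj_fun g) (conj_fun g^-1)
    (@conj_funK g) (@conj_funVK g).

Definition conj_Out (g : G) : Out (set_type N) := out_class (conj_aut g).

End ConjugationAction.

(* Main.v *)
Require Import Defs.
From HB Require Import structures.
From mathcomp Require Import all_boot all_fingroup.
From mathcomp Require Import boolp classical_sets functions cardinality.
From mathcomp Require Import mathcomp_extra topology.

(* If a completion K exists, the induced map u : G -> K is injective on G1 and
   G2. Its kernel meets the core N trivially, hence centralizes N, so the action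
   of g on N modulo inner automorphisms depends only on u g modulo an open
   subgroup of K.

   Conversely, properness makes N open in H, and finiteness of the outer action
   gives a finite quotient q : G -> Q with kernel M such that N is the
   intersection of M with each G_i, and M = N D where D = M `&` C(N). Let
   Z = Z(N). It suffices to find a closed normal subgroup L of G, inside D, with
   L `&` N = 1 and L N of finite index: then K = G / L is a completion.

   A section s of q adapted to G1 gives a Kaloujnine-Krasner embedding of G into
   the wreath product of G and Q that sends G1 into that of N and Q; another one,
   d s with d in D, does so for G2, and d can be chosen so that both agree on H.
   By the universal property they glue to a homomorphism F with values in the
   wreath product of N and Q. On D, its components, suitably conjugated, are
   homomorphisms E x : D -> Z which are permuted by G and restrict to the
   identity on Z. Thus D maps to the abelian group Z^Q, with Z the diagonal, and
   averaging over Q (the map psi) makes y |-> y^n psi(y)^-1, n = #|Q|, an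
   equivariant projection away from Z, up to torsion. The torsion is harmless:
   modulo Z the image of D is topologically generated by the finite set d(Q), so
   it has finitely many elements of order dividing n, and a small open subgroup
   avoids the finitely many bad values in Z. *)

Set Implicit Arguments.
Unset Strict Implicit.
Unset Printing Implicit Defensive.

Local Open Scope classical_set_scope.
Local Open Scope group_scope.

(** * Continuous maps, locally constant maps and inverse limits *)

Section ContinuousOperations.
Variables (T : topologicalType) (G : topologicalGroupType).
Implicit Types f h : T -> G.

Lemma continuousM f h :
  continuous f -> continuous h -> continuous (fun x => f x * h x).
Proof.
move=> fc hc x.
have pc : (fun x => (f x, h x)) @ x --> (f x, h x).
  apply: (@cvg_pair _ _ _ _ (nbhs (f x)) (nbhs (h x))).
  - exact: fc.
  - exact: hc.
exact: (cvg_comp _ _ pc (@mulg_continuous G (f x, h x))).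
Qed.

Lemma continuousV f : continuous f -> continuous (fun x => (f x)^-1).
Proof. by move=> fc x; exact: (cvg_comp _ _ (fc x) (@invg_continuous G (f x))). Qed.

Lemma continuousJ f h :
  continuous f -> continuous h -> continuous (fun x => f x ^ h x).
Proof. by move=> fc hc; apply: continuousM; [exact: continuousV|exact: continuousM]. Qed.

Lemma continuousX f n : continuous f -> continuous (fun x => f x ^+ n).
Proof.
move=> fc; elim: n => [|n IHn]; first exact: cst_continuous.
rewrite (_ : (fun x => _) = fun x => f x * f x ^+ n); first exact: continuousM.
by apply/funext => x; rewrite expgS.
Qed.

Lemma continuous_prod (I : Type) (r : seq I) (f : I -> T -> G) :
  (forall i, continuous (f i)) -> continuous (fun x => \prod_(i <- r) f i x).
Proof.
move=> fc; elim: r => [|i r IHr].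
  by under eq_fun do rewrite big_nil; exact: cst_continuous.
by under eq_fun do rewrite big_cons; exact: continuousM.
Qed.

End ContinuousOperations.

Lemma closed_preimage (T U : topologicalType) (f : T -> U) (A : set U) :
  continuous f -> closed A -> closed (f @^-1` A).
Proof. by move=> /continuous_closedP; exact. Qed.

Lemma open_preimage (T U : topologicalType) (f : T -> U) (A : set U) :
  continuous f -> open A -> open (f @^-1` A).
Proof. by move=> /continuousP; exact. Qed.

Lemma continuous_compose (T U V : topologicalType) (f : T -> U) (g : U -> V) :
  continuous f -> continuous g -> continuous (fun x => g (f x)).
Proof.
move=> fc gc; apply/continuousP => B oB.
by apply: (@open_preimage _ _ f (g @^-1` B)) => //; exact: open_preimage.
Qed.

Lemma compact_image (T U : topologicalType) (f : T -> U) (A : set T) :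
  continuous f -> compact A -> compact (f @` A).
Proof. by move=> fc; apply: continuous_compact; exact: continuous_subspaceT. Qed.

(** Continuity for the discrete topology on [A], for a bare type [A], so that finite groups need not
    carry a topology. *)
Definition locally_constant (T : topologicalType) (A : Type) (f : T -> A) :=
  forall B : set A, open (f @^-1` B).

Section LocallyConstant.
Variables (T : topologicalType) (A : Type) (f : T -> A).
Hypothesis fl : locally_constant f.

Lemma locally_constant_closed (B : set A) : closed (f @^-1` B).
Proof. by rewrite -[closed _]openC; exact: (fl (~` B)). Qed.

Lemma locally_constant_comp (B : Type) (h : A -> B) : locally_constant (h \o f).
Proof. by move=> C; exact: (fl (h @^-1` C)). Qed.

Lemma locally_constant_pair (B : Type) (h : T -> B) :
  locally_constant h -> locally_constant (fun x => (f x, h x)).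
Proof.
move=> hl C; rewrite (_ : _ @^-1` _ =
    \bigcup_(c in C) (f @^-1` [set c.1] `&` h @^-1` [set c.2])).
  by apply: bigcup_open => c _; apply: openI; [exact: fl|exact: hl].
apply/seteqP; split => x /=; first by exists (f x, h x).
by case=> -[a b] Cab /= [-> ->].
Qed.

Lemma locally_constant_precomp (U : topologicalType) (h : U -> T) :
  continuous h -> locally_constant (f \o h).
Proof. by move=> hc B; rewrite comp_preimage; exact: open_preimage. Qed.

Lemma locally_constant_continuous (U : topologicalType) (h : A -> U) :
  continuous (h \o f).
Proof. by apply/continuousP => B _; exact: (fl (h @^-1` B)). Qed.

End LocallyConstant.

Lemma locally_constant_ffun (T : topologicalType) (I : finType) (A : Type)
    (f : T -> {ffun I -> A}) :
  (forall i, locally_constant (fun x => f x i)) -> locally_constant f.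
Proof.
move=> fl B; rewrite openE => x Bfx; rewrite /interior.
suff : \forall y \near x, forall i, f y i = f x i.
  apply: filterS => y yx; rewrite /preimage /=.
  by rewrite (_ : f y = f x)//; apply/ffunP.
suff : \forall y \near x, forall i, i \in enum I -> f y i = f x i.
  by apply: filterS => y yx i; apply: yx; rewrite mem_enum.
elim: (enum I) => [|j r IHr]; first exact: nearW.
have jx : \forall y \near x, f y j = f x j.
  by apply: open_nbhs_nbhs; split => //; exact: (fl j [set f x j]).
apply: filterS2 jx IHr => y yj yr i; rewrite inE => /orP[/eqP->//|]; exact: yr.
Qed.

Section ProductTopology.
Variables (I : Type) (T : I -> topologicalType).

Lemma prod_topology_cvg (F : set_system (prod_topology T)) (x : prod_topology T) :
  Filter F -> (forall i, (fun y : prod_topology T => y i) @ F --> x i) -> F --> x.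
Proof.
move=> FF Fx; apply/cvg_sup => i.
(* [w] is a section of the [i]-th projection, so every set in the factor is the image of its
   preimage. *)
pose w a := @dfwith {classic I} T x i a.
have wi a : w a i = a by exact: dfwithin.
apply/cvg_image; first by apply/seteqP; split => // a _; exists (w a).
move=> A /= xA; exists [set y | A (y i)]; first exact: (Fx i).
by apply/seteqP; split => [_ [y yA <-]//|a Aa]; exists (w a); rewrite ?/mkset ?wi.
Qed.

Lemma prod_topology_proj i : continuous (fun x : prod_topology T => x i).
Proof. exact: (@proj_continuous {classic I} _ i). Qed.

Lemma prod_topology_continuous (U : topologicalType) (f : U -> prod_topology T) :
  (forall i, continuous (fun u => f u i)) -> continuous f.
Proof. by move=> fc u; apply: prod_topology_cvg => i; exact: fc. Qed.

End ProductTopology.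

Section InverseLimit.
Variables (S : inverse_system) (G : topologicalGroupType).
Variables (p : forall i : idx S, UMagmaMorphism.type G (term i)).
Hypothesis pl : is_inverse_limit p.

Lemma limit_sep x y : (forall i, p i x = p i y) -> x = y.
Proof. by move=> xy; apply: (limit_inj pl); apply: functional_extensionality_dep. Qed.

Lemma limit_bond i j x : idx_le i j -> bond i j (p j x) = p i x.
Proof.
move=> ij; have : range (to_product p) (to_product p x) by exists x.
by rewrite (limit_range pl); exact.
Qed.

Lemma limit_ex (x : forall i : idx S, term i) :
  (forall i j, idx_le i j -> bond i j (x j) = x i) -> exists g, forall i, p i g = x i.
Proof.
move=> xb; have : [set x | forall i j : idx S, idx_le i j -> bond i j (x j) = x i] x.
  by [].
by rewrite -(limit_range pl) => -[g _ <-]; exists g.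
Qed.

Lemma to_product_cts : continuous (to_product p).
Proof. by apply/continuousP => B oB; apply/(limit_open pl); exists B. Qed.

Lemma limit_locally_constant i : locally_constant (p i).
Proof.
move=> B; apply: (@open_preimage _ _ (fun x => to_product p x i) B).
  apply/continuousP => C oC; rewrite (_ : _ @^-1` _ =
    to_product p @^-1` ((fun x => x i) @^-1` C))//.
  apply: open_preimage; first exact: to_product_cts.
  by apply: open_preimage => //; exact: prod_topology_proj.
exact: (@discrete_open (discrete_topology (term i))).
Qed.

(** Directedness makes the fibres of the [p i] through [x] a filter basis. It converges to [x] in
    the product because it does so in each coordinate. *)
Lemma limit_basis (U : set G) x : open U -> U x ->
  exists i, forall y, p i y = p i x -> U y.
Proof.
move=> /(limit_open pl) [B oB <-] Bx.
pose F := filter_from setT (fun i => [set y | p i y = p i x]).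
have FF : Filter F.
  apply: filter_from_filter; first by have [i _] := idx_nonempty S; exists i.
  move=> i j _ _; have [k [ik jk]] := idx_directed i j; exists k => // y /= yk.
  by split; [rewrite /= -!(limit_bond _ ik) yk|rewrite /= -!(limit_bond _ jk) yk].
have Fc : to_product p @ F --> to_product p x.
  apply: prod_topology_cvg => i A iA.
  by exists i => // y /= yx; rewrite /to_product yx; exact: (nbhs_singleton iA).
have [i _ iB] : (to_product p @ F) B by apply: Fc; exact: open_nbhs_nbhs.
by exists i => y /iB.
Qed.

Lemma limit_basis1 (U : set G) : open U -> U 1 ->
  exists i, forall y, p i y = 1 -> U y.
Proof. by move=> oU /(limit_basis oU)[i iU]; exists i => y y1; apply: iU; rewrite gmulf1. Qed.

Lemma limit_continuous (T : topologicalType) (f : T -> G) :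
  (forall i, locally_constant (p i \o f)) -> continuous f.
Proof.
move=> fl; apply/continuousP => B oB; rewrite openE => x Bfx.
have [i iB] := limit_basis oB Bfx; rewrite /interior.
apply: (@filterS _ _ _ ((p i \o f) @^-1` [set p i (f x)])); first by move=> y /iB.
by apply: open_nbhs_nbhs; split => //; exact: fl.
Qed.

Lemma limit_hausdorff : hausdorff_space G.
Proof.
rewrite open_hausdorff => x y xy.
have [i xyi] : exists i, p i x <> p i y.
  by apply/existsNP => xyi; move/eqP: xy; apply; exact: limit_sep.
exists (p i @^-1` [set p i x], p i @^-1` [set p i y]); first by rewrite !inE.
split; [exact: limit_locally_constant|exact: limit_locally_constant|].
apply/eqP/seteqP; split => // z /= [zx zy]; apply: xyi; exact: etrans (esym zx) zy.
Qed.

Lemma limit_compact : compact [set: G].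
Proof.
pose P := prod_topology (fun i : idx S => discrete_topology (term i)).
have cP : compact [set: P].
  have -> : [set: P] = [set f | forall i, [set: discrete_topology (term i)] (f i)].
    by apply/seteqP; split.
  apply: (@tychonoff {classic idx S} (fun i => discrete_topology (term i))
    (fun=> setT)) => i; apply: finite_compact.
  exact: (@finite_finset (term i)).
have cl : closed (range (to_product p)).
  rewrite (limit_range pl) (_ : [set x | _] = \bigcap_i \bigcap_(j in idx_le i)
    [set x : P | bond i j (x j) = x i]); last first.
    by apply/seteqP; split => x /= xb i; [move=> _ j; exact: xb|move=> j; exact: (xb i I)].
  apply: closed_bigI => i _; apply: closed_bigI => j _.
  have plc k : locally_constant (fun x : P => x k).
    move=> B; apply: open_preimage; first exact: prod_topology_proj.
    exact: (@discrete_open (discrete_topology (term k))).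
  have := locally_constant_closed (locally_constant_pair (plc j) (plc i)).
  by move=> /(_ [set u | bond i j u.1 = u.2]).
have cR : compact (range (to_product p)).
  by have := subclosed_compact cl cP; apply => x _.
move=> F FF FT.
(* The compatible families form a closed, hence compact, subset of the Tychonoff product. A cluster
   point of the pushed filter lifts to [G], whose topology is induced by [to_product p]. *)
pose F' := to_product p @ F.
have [x [[g _ <-] gF]] : range (to_product p) `&` cluster F' !=set0.
  by apply: cR; apply: (@filterS _ F _ setT) => // g _; exists g.
exists g; split => // A B FA /=; rewrite nbhsE => -[U [oU Ug] UB].
have /(limit_open pl) [V oV VU] := oU; rewrite -VU in Ug.
have F'A : F' (to_product p @` A) by apply: (@filterS _ F _ A) => // a Aa; exists a.
have [_ [[a Aa <-] Va]] := gF _ V F'A (open_nbhs_nbhs (conj oV Ug)).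
by exists a; split => //; apply: UB; rewrite -VU.
Qed.

End InverseLimit.

(** * Finite quotients and extensions of groups *)

Lemma group_hom_subproof (G H : groupType) (f : G -> H) :
  {morph f : x y / x * y} -> {morph f : x y / x * y^-1}.
Proof. by move=> fM x y; rewrite -[in RHS](mulgVK y x) [in RHS]fM mulgK. Qed.

Definition group_hom (G H : groupType) (f : G -> H)
    (fM : {morph f : x y / x * y}) : UMagmaMorphism.type G H :=
  HB.pack f (isGroupMorphism.Build G H f (group_hom_subproof fM)).

Record is_subgroup (G : groupType) (X : set G) : Prop := {
  sub1 : X 1;
  subM : forall x y, X x -> X y -> X (x * y);
  subV : forall x, X x -> X x^-1
}.

Definition is_normal (G : groupType) (X : set G) :=
  forall x g, X x -> X (x ^ g).

Section Subgroups.
Variables (G K : groupType) (f : UMagmaMorphism.type G K).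

Lemma is_subgroupP (A : subgroup G) : is_subgroup A.
Proof. by case: A => X X1 XM XV. Qed.

Lemma is_subgroupI (X Y : set G) :
  is_subgroup X -> is_subgroup Y -> is_subgroup (X `&` Y).
Proof.
by case=> X1 XM XV [Y1 YM YV]; split => // [x y [Xx Yx] [Xy Yy]|x [Xx Yx]];
  split; auto.
Qed.

Lemma is_subgroup_image (X : set G) : is_subgroup X -> is_subgroup (f @` X).
Proof.
case=> X1 XM XV; split; first by exists 1; rewrite ?gmulf1.
  by move=> _ _ [x Xx <-] [y Xy <-]; exists (x * y); rewrite ?gmulfM; auto.
by move=> _ [x Xx <-]; exists x^-1; rewrite ?gmulfV; auto.
Qed.

Lemma is_subgroup_range : is_subgroup (range f).
Proof. by apply: is_subgroup_image; split. Qed.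

Lemma is_subgroup_one : is_subgroup [set (1 : G)].
Proof. by split=> [|x y -> ->|x ->]; rewrite /= ?mulg1 ?invg1. Qed.

Lemma is_subgroup_preimage (Y : set K) : is_subgroup Y -> is_subgroup (f @^-1` Y).
Proof.
by case=> Y1 YM YV; split => [|x y|x]; rewrite /preimage /= ?(gmulf1, gmulfM, gmulfV); auto.
Qed.

End Subgroups.

Section FiniteClass.
Variable C : finGroupType -> Prop.
Hypothesis C_closed : closed_class C.

Lemma fin_subgroup (A : finGroupType) (X : set A) : is_subgroup X ->
  exists B : {group A}, forall x, x \in B <-> X x.
Proof.
case=> X1 XM XV.
have gB : group_set [set x | `[< X x >]]%SET.
  by apply/group_setP; split=> [|x y]; rewrite !inE //; exact: XM.
by exists (Group gB) => x; rewrite inE; split=> /asboolP.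
Qed.

Lemma class_subgroup (A : finGroupType) (X : set A) : is_subgroup X -> C A ->
  exists2 B : finGroupType, C B & exists i : UMagmaMorphism.type B A,
    injective i /\ range i = X.
Proof.
move=> gX CA; have [B BX] := fin_subgroup gX.
pose i := @group_hom (subg_of B) A sgval (fun _ _ => erefl).
have i_inj : injective i by exact: val_inj.
exists (subg_of B); first exact: (closed_sub C_closed i_inj).
exists i; split => //; apply/seteqP; split => [_ [x _ <-]|x /BX xB].
  by apply/BX; exact: subgP.
by exists (subg B x) => //; rewrite /i /= subgK.
Qed.

(** The quotient is p(G)/p(L). One first passes to the image p(G), since p(L) is normalized by p(G)
    but perhaps not by [A]. *)
Lemma class_quotient (G : groupType) (A : finGroupType)
    (p : UMagmaMorphism.type G A) (L : set G) :
  C A -> is_subgroup L -> is_normal L ->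
  exists2 B : finGroupType, C B & exists q : UMagmaMorphism.type G B,
    range q = setT /\ forall g, q g = 1 <-> exists2 l, L l & p l = p g.
Proof.
move=> CA gL nL.
have [P PE] := fin_subgroup (is_subgroup_range p).
have [N NE] := fin_subgroup (is_subgroup_image p gL).
have inP g : p g \in P by apply/PE; exists g.
have inN l : L l -> p l \in N by move=> Ll; apply/NE; exists l.
have nNP : P \subset 'N(N).
  apply/fintype.subsetP => x /PE[g _ <-]; rewrite inE; apply/fintype.subsetP => y.
  rewrite mem_conjg => /NE -[l Ll lE].
  apply/NE; exists (l ^ g); first exact: nL.
  by rewrite gmulfJ lE conjgKV.
have nNp g : p g \in 'N(N) by apply: (fintype.subsetP nNP).
have qin g : coset N (p g) \in (P / N)%g by apply: mem_quotient.
pose f g := subg (P / N)%G (coset N (p g)).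
have fM : {morph f : x y / x * y}.
  move=> x y; rewrite /f gmulfM morphM ?nNp//; apply: val_inj.
  by rewrite /= !subgK ?groupM ?qin.
(* [h] exhibits the quotient as an image of p(G), a subgroup of [A]; this puts it in [C]. *)
pose h (x : subg_of P) := subg (P / N)%G (coset N (sgval x)).
have hM : {morph h : x y / x * y}.
  have inPN (x : subg_of P) : sgval x \in 'N(N).
    by apply: (fintype.subsetP nNP); exact: subgP.
  move=> x y; apply: (can_inj (@sgvalK _ _)); rewrite /h /= morphM ?inPN//.
  by rewrite !subgK ?groupM ?mem_quotient ?subgP.
have CP : C (subg_of P).
  pose i := @group_hom (subg_of P) A sgval (fun _ _ => erefl).
  by apply: (closed_sub C_closed (f := i)) => //; exact: val_inj.
have hT : range (group_hom hM) = setT.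
  apply/seteqP; split => // y _; have := subgP y => /morphimP[x xN xP yE].
  by exists (subg P x) => //=; rewrite /h subgK// -yE sgvalK.
exists (subg_of (P / N)%G); first exact: (closed_quotient C_closed hT).
exists (group_hom fM); split.
  apply/seteqP; split => // y _; have := subgP y => /morphimP[x xN /PE[g _ gx] yE].
  by exists g => //=; rewrite /f gx -yE sgvalK.
move=> g; rewrite /= /f; split => [/(congr1 sgval)|[l Ll lg]].
  by rewrite subgK// => /coset_idr -/(_ (nNp g)) /NE [l Ll lg]; exists l.
by rewrite -lg coset_id ?inN//; exact: (morph1 (subg_morphism (P / N)%G)).
Qed.

End FiniteClass.

(** * Wreath products of finite groups *)

Section Wreath.
Variables A Q : finGroupType.

Definition power : Type := {ffun Q -> A}.
HB.instance Definition _ := Finite.on power.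
HB.instance Definition _ := Group.on power.

(** [Q] acts on functions by right translation of the argument, the convention that fits right
    multiplication in the cocycle identity below. *)
Definition wreath : Type := {ffun Q -> A} * Q.

HB.instance Definition _ := Finite.on wreath.

Let one : wreath := ([ffun=> 1], 1).
Let mul (v w : wreath) : wreath :=
  ([ffun x => v.1 x * w.1 (x * v.2)], v.2 * w.2).
Let inv (v : wreath) : wreath := ([ffun x => (v.1 (x * v.2^-1))^-1], v.2^-1).

Let wreath_eq (v w : wreath) : v.1 =1 w.1 -> v.2 = w.2 -> v = w.
Proof. by case: v w => [a x] [b y] /= ab ->; congr (_, _); apply/ffunP. Qed.

Let mulA : associative mul.
Proof.
by move=> u v w; apply: wreath_eq => [x|]; rewrite /= ?ffunE ?mulgA//= ?ffunE !mulgA.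
Qed.
Let mul1 : left_id one mul.
Proof. by move=> w; apply: wreath_eq => [x|]; rewrite /= ?ffunE ?mul1g ?mulg1. Qed.
Let mulr1 : right_id one mul.
Proof. by move=> w; apply: wreath_eq => [x|]; rewrite /= ?ffunE ?mulg1. Qed.
Let mulV : left_inverse one inv mul.
Proof. by move=> w; apply: wreath_eq => [x|]; rewrite /= ?ffunE ?mulVg. Qed.
Let mulrV : right_inverse one inv mul.
Proof. by move=> w; apply: wreath_eq => [x|]; rewrite /= ?ffunE ?mulgK ?mulgV. Qed.

HB.instance Definition _ := isGroup.Build wreath mulA mul1 mulr1 mulV mulrV.

Lemma wreathM (v w : wreath) :
  v * w = ([ffun x => v.1 x * w.1 (x * v.2)], v.2 * w.2).
Proof. by []. Qed.

End Wreath.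

Section WreathClass.
Variable C : finGroupType -> Prop.
Hypothesis C_closed : closed_class C.

(** Induction on the family: [E] is an extension of a quotient isomorphic to a subgroup of [A] by
    the kernel of the first map, on which the remaining maps still separate points. With no map
    left, [E] is trivial and embeds in [A]. *)
Lemma class_residual (A : finGroupType) (I : eqType) (s : seq I)
    (E : finGroupType) (q : I -> UMagmaMorphism.type E A) : C A ->
  (forall x, (forall i, i \in s -> q i x = 1) -> x = 1) -> C E.
Proof.
move=> CA; elim: s E q => [|j s IHs] E q q1.
  pose t := @group_hom E A (fun=> 1) (fun _ _ => esym (mulg1 1)).
  by apply: (closed_sub C_closed (f := t)) => // x y _; rewrite (q1 x)// (q1 y).
have gK : is_subgroup [set x | q j x = 1].
  exact: (is_subgroup_preimage (q j) (is_subgroup_one A)).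
have nK : is_normal [set x | q j x = 1] by move=> x g /= x1; rewrite gmulfJ x1 conj1g.
have [K KE] := fin_subgroup gK.
have CK : C (subg_of K).
  have rM i : {morph (fun x : subg_of K => q i (sgval x)) : x y / x * y}.
    by move=> x y; rewrite -gmulfM.
  apply: (IHs _ (fun i => group_hom (rM i))) => x x1.
  apply: val_inj; apply: q1 => i; rewrite inE => /orP[/eqP->|/x1//].
  by apply/KE; exact: subgP.
have [B CB [r [rT rE]]] := class_quotient C_closed (q j) CA gK nK.
apply: (closed_extension C_closed
  (i := @group_hom (subg_of K) E sgval (fun _ _ => erefl)) _ rT _ CK CB).
  exact: val_inj.
apply/seteqP; split => [_ [x _ <-]|x /= /rE[l l1 lx]].
  by apply/rE; exists 1; rewrite /= gmulf1//; apply/esym/KE; exact: subgP.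
have xK : x \in K by apply/KE; rewrite /= -lx.
by exists (subg K x) => //=; rewrite subgK.
Qed.

Lemma class_wreath (A Q : finGroupType) : C A -> C Q -> C (wreath A Q).
Proof.
move=> CA CQ.
have CF : C (power A Q).
  pose ev (x : Q) := @group_hom (power A Q) A (fun a => a x)
    (fun a b => ffunE _ x).
  apply: (@class_residual A Q (enum Q) (power A Q) ev CA) => a a1.
  by apply/ffunP => x; rewrite [LHS](a1 x) ?mem_enum// ffunE.
have iM : {morph (fun a : power A Q => (a, 1) : wreath A Q) : a b / a * b}.
  move=> a b; rewrite wreathM /= mulg1; congr (_, _).
  by apply/ffunP => x; rewrite !ffunE mulg1.
have qM : {morph (snd : wreath A Q -> Q) : v w / v * w} by [].
apply: (closed_extension C_closed (i := group_hom iM) (q := group_hom qM) _ _ _ CF CQ).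
- by move=> a b [].
- by apply/seteqP; split => // x _; exists ([ffun=> 1], x).
- by apply/seteqP; split => [_ [a _ <-]//|[a x] /= ->]; exists a.
Qed.

End WreathClass.

Section DiscreteGroup.
Variable A : finGroupType.

HB.instance Definition _ := Group.copy (discrete_topology A) A.

Let discrete_cts (T : topologicalType) (f : T -> discrete_topology A) :
  locally_constant f -> continuous f.
Proof. by move=> fl; apply/continuousP => B _; exact: fl. Qed.

Let pair_nbhs (x : discrete_topology A * discrete_topology A) : nbhs x [set x].
Proof.
exists ([set x.1], [set x.2]); first by split; exact: discrete_set1.
by case: x => a b [c d] /= [-> ->].
Qed.

Let mul_cts : continuous
  (fun x : discrete_topology A * discrete_topology A => x.1 * x.2).
Proof.
apply: discrete_cts => B; rewrite openE => x Bx; rewrite /interior.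
by apply: filterS (pair_nbhs x) => y ->.
Qed.

Let inv_cts : continuous (fun x : discrete_topology A => x^-1).
Proof. by apply: discrete_cts => B; exact: discrete_open. Qed.

HB.instance Definition _ :=
  isTopologicalGroup.Build (discrete_topology A) mul_cts inv_cts.

End DiscreteGroup.

(** * The universal property on finite groups *)

Definition continuous_hom (G K : topologicalGroupType) (f : G -> K)
    (fM : {morph f : x y / x * y}) (fc : continuous f) :
    {continuous_morphism G -> K} :=
  HB.pack f (isGroupMorphism.Build G K f (group_hom_subproof fM))
    (isContinuous.Build G K f fc).

Lemma morphism_continuous (G K : topologicalGroupType)
  (f : {continuous_morphism G -> K}) : continuous f.
Proof. exact: cts_fun. Qed.

Lemma locally_constant_discrete (T : topologicalType) (A : finGroupType)
  (f : T -> discrete_topology A) : continuous f <-> locally_constant f.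
Proof.
split=> [fc B|fl]; last by apply/continuousP => B _; exact: fl.
by apply: open_preimage => //; exact: discrete_open.
Qed.

Lemma hom_locally_constant (G : topologicalGroupType) (A : groupType)
    (r : UMagmaMorphism.type G A) (U : set G) :
  open U -> U 1 -> (forall g, U g -> r g = 1) -> locally_constant r.
Proof.
move=> oU U1 rU B; rewrite openE => g Bg; rewrite /interior.
apply: (@filterS _ _ _ ((fun h => g^-1 * h) @^-1` U)).
  move=> h /= /rU; rewrite gmulfM gmulfV /preimage /= => /(congr1 (fun z => r g * z)).
  by rewrite mulVKg mulg1 => ->.
apply: open_nbhs_nbhs; split; last by rewrite /preimage /= mulVg.
apply: open_preimage => //; apply: continuousM; first exact: cst_continuous.
by move=> ?; exact: cvg_id.
Qed.

Section SingletonSystem.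
Variable A : finGroupType.

Definition constant_system : inverse_system.
Proof.
pose b (_ _ : unit) := @group_hom A A id (fun _ _ => erefl).
apply: (@InverseSystem unit (fun _ _ => True) _ _ _ _ _ (fun=> A) b) => //.
by case; case.
Defined.

Lemma pro_discrete (C : finGroupType -> Prop) :
  C A -> pro C (discrete_topology A).
Proof.
move=> CA; exists constant_system => //.
exists (fun=> @group_hom (discrete_topology A) A id (fun _ _ => erefl)).
split.
- by move=> x y /(congr1 (fun f => f tt)).
- apply/seteqP; split => [_ [a _ <-] []//|x _]; exists (x tt) => //.
  by apply: functional_extensionality_dep; case.
- move=> U; split=> _; last exact: discrete_open.
  exists ((fun x : prod_topology (fun=> discrete_topology A) => x tt) @^-1` U) => //.
  apply: open_preimage; last exact: discrete_open.
  exact: (@prod_topology_proj unit (fun=> discrete_topology A) tt).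
Qed.

End SingletonSystem.

Section Amalgam.
Variables (C : finGroupType -> Prop) (H G1 G2 G : topologicalGroupType).
Hypothesis C_closed : closed_class C.
Variables (i1 : {continuous_morphism H -> G1}) (i2 : {continuous_morphism H -> G2}).
Variables (phi1 : {continuous_morphism G1 -> G}) (phi2 : {continuous_morphism G2 -> G}).
Hypothesis G_amalgam : amalgamated_product C i1 i2 phi1 phi2.

Lemma amalgam_fin (A : finGroupType) (k1 : UMagmaMorphism.type G1 A)
    (k2 : UMagmaMorphism.type G2 A) :
  C A -> locally_constant k1 -> locally_constant k2 -> k1 \o i1 =1 k2 \o i2 ->
  exists u : UMagmaMorphism.type G A,
    [/\ locally_constant u, u \o phi1 =1 k1 & u \o phi2 =1 k2].
Proof.
move=> CA l1 l2 k12.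
pose f1 := @continuous_hom G1 (discrete_topology A) k1 (@gmulfM _ _ k1)
  (proj2 (locally_constant_discrete _) l1).
pose f2 := @continuous_hom G2 (discrete_topology A) k2 (@gmulfM _ _ k2)
  (proj2 (locally_constant_discrete _) l2).
have [u [u1 u2 _]] := amalgam_univ G_amalgam (f1 := f1) (f2 := f2) (pro_discrete CA) k12.
exists (@group_hom G A u (@gmulfM _ _ u)); split => //.
exact/locally_constant_discrete/morphism_continuous.
Qed.

Lemma amalgam_fin_uniq (A : finGroupType) (u v : UMagmaMorphism.type G A) :
  C A -> locally_constant u -> locally_constant v ->
  u \o phi1 =1 v \o phi1 -> u \o phi2 =1 v \o phi2 -> u =1 v.
Proof.
move=> CA ul vl uv1 uv2.
pose u' := @continuous_hom G (discrete_topology A) u (@gmulfM _ _ u)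
  (proj2 (locally_constant_discrete _) ul).
pose v' := @continuous_hom G (discrete_topology A) v (@gmulfM _ _ v)
  (proj2 (locally_constant_discrete _) vl).
pose f1 := @continuous_hom G1 (discrete_topology A) (v \o phi1) (@gmulfM _ _ (v \o phi1))
  (proj2 (locally_constant_discrete _)
    (locally_constant_precomp vl (@morphism_continuous _ _ phi1))).
pose f2 := @continuous_hom G2 (discrete_topology A) (v \o phi2) (@gmulfM _ _ (v \o phi2))
  (proj2 (locally_constant_discrete _)
    (locally_constant_precomp vl (@morphism_continuous _ _ phi2))).
have f12 : f1 \o i1 =1 f2 \o i2.
  by move=> h; rewrite /= -[phi1 _]/((phi1 \o i1) h) (amalgam_comm G_amalgam).
have [w [_ _ wu]] := amalgam_univ G_amalgam (f1 := f1) (f2 := f2) (pro_discrete CA) f12.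
move=> g; transitivity (w g); first exact: (wu u').
exact/esym/(wu v').
Qed.

(** If [g] is outside the closed set [X], some [p i] separates it from [X]. The restrictions of
    [p i] to [G1] and [G2] take values in p_i(X), so they glue to a map from [G] into p_i(X), which
    by uniqueness is [p i] itself: a contradiction. *)
Lemma amalgam_dense (X : set G) : is_subgroup X -> closed X ->
  (forall g, X (phi1 g)) -> (forall g, X (phi2 g)) -> X = setT.
Proof.
move=> gX cX X1 X2; apply/seteqP; split => // g _.
have [S CS [p pl]] := amalgam_pro G_amalgam.
apply: contrapT => Xg.
have [i iX] := limit_basis pl (closed_openC cX) Xg.
have [B CB [j [j_inj jX]]] :=
  class_subgroup C_closed (is_subgroup_image (p i) gX) (CS i).
have lift (K : topologicalGroupType) (f : {continuous_morphism K -> G}) :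
    (forall x, X (f x)) -> exists2 k : UMagmaMorphism.type K B,
      locally_constant k & forall x, j (k x) = p i (f x).
  move=> Xf; have /choice[k kE] x : exists b, j b = p i (f x).
    have : range j (p i (f x)) by rewrite jX; exists (f x).
    by case=> b _ <-; exists b.
  have kM : {morph k : x y / x * y}.
    by move=> x y; apply: j_inj; rewrite gmulfM !kE !gmulfM.
  exists (group_hom kM) => // D.
  rewrite (_ : _ @^-1` D = (p i \o f) @^-1` (j @` D)).
    apply: (locally_constant_precomp (limit_locally_constant pl (i := i))).
    exact: morphism_continuous.
  apply/seteqP; split => x /=; first by move=> Dx; exists (k x).
  by case=> b Db; rewrite -kE => /j_inj <-.
have [k1 l1 k1E] := lift _ _ X1; have [k2 l2 k2E] := lift _ _ X2.
have k12 : k1 \o i1 =1 k2 \o i2.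
  move=> h; apply: j_inj; rewrite /= k1E k2E.
  by rewrite -[phi1 _]/((phi1 \o i1) h) (amalgam_comm G_amalgam).
have [u [ul u1 u2]] := amalgam_fin CB l1 l2 k12.
have ju : j \o u =1 p i.
  apply: amalgam_fin_uniq => //.
  - exact: locally_constant_comp.
  - exact: limit_locally_constant.
  - by move=> x; rewrite /= -k1E -u1.
  - by move=> x; rewrite /= -k2E -u2.
have : range j (j (u g)) by exists (u g).
by rewrite jX => -[x Xx xE]; apply: (iX x _ Xx); rewrite xE -ju.
Qed.

End Amalgam.

(** * Quotients of pro-C groups *)

Section ProductGroup.
Variables (I : Type) (T : I -> topologicalGroupType).
Implicit Types x y z : prod_topology T.

Let one : prod_topology T := fun=> 1.
Let mul x y : prod_topology T := fun i => x i * y i.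
Let inv x : prod_topology T := fun i => (x i)^-1.

Let ext x y : (forall i, x i = y i) -> x = y.
Proof. exact: functional_extensionality_dep. Qed.

Let mulA : associative mul.
Proof. by move=> x y z; apply: ext => i; exact: mulgA. Qed.
Let mul1 : left_id one mul.
Proof. by move=> x; apply: ext => i; exact: mul1g. Qed.
Let mulr1 : right_id one mul.
Proof. by move=> x; apply: ext => i; exact: mulg1. Qed.
Let mulV : left_inverse one inv mul.
Proof. by move=> x; apply: ext => i; exact: mulVg. Qed.
Let mulrV : right_inverse one inv mul.
Proof. by move=> x; apply: ext => i; exact: mulgV. Qed.

HB.instance Definition _ :=
  isGroup.Build (prod_topology T) mulA mul1 mulr1 mulV mulrV.

Let mul_cts : continuous (fun x : prod_topology T * prod_topology T => x.1 * x.2).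
Proof.
apply: (@prod_topology_continuous I T) => i; apply: continuousM => x.
- exact: (cvg_comp fst (fun y : prod_topology T => y i) cvg_fst
    (@prod_topology_proj I T i x.1)).
- exact: (cvg_comp snd (fun y : prod_topology T => y i) cvg_snd
    (@prod_topology_proj I T i x.2)).
Qed.

Let inv_cts : continuous (fun x : prod_topology T => x^-1).
Proof.
apply: (@prod_topology_continuous I T) => i; apply: continuousV.
exact: prod_topology_proj.
Qed.

HB.instance Definition _ :=
  isTopologicalGroup.Build (prod_topology T) mul_cts inv_cts.

End ProductGroup.

Section LimitGroup.
Variable S : inverse_system.
Let P : topologicalGroupType := prod_topology (fun i : idx S => discrete_topology (term i)).
Let X : set P := [set x | forall i j, idx_le i j -> bond i j (x j) = x i].

Let X1 : X 1. Proof. by move=> i j _; exact: gmulf1. Qed.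
Let XM x y : X x -> X y -> X (x * y).
Proof.
move=> Xx Xy i j ij; transitivity (bond i j (x j) * bond i j (y j)).
  exact: gmulfM.
by rewrite Xx// Xy.
Qed.
Let XV x : X x -> X x^-1.
Proof. by move=> Xx i j ij; transitivity (bond i j (x j))^-1; [exact: gmulfV|rewrite Xx]. Qed.

Definition limit_group : topologicalGroupType := set_type (Subgroup X1 XM XV).

Definition limit_proj (i : idx S) : UMagmaMorphism.type limit_group (term i) :=
  @group_hom limit_group (term i) (fun x => val x i) (fun _ _ => erefl).

Lemma limit_groupP : is_inverse_limit limit_proj.
Proof.
split.
- by move=> x y xy; apply: val_inj.
- apply/seteqP; split => [_ [x _ <-]|x Xx]; first exact: (set_mem (valP x)).
  by exists (exist _ x (mem_set Xx)).
- by move=> U; split => -[B oB BU]; exists B.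
Qed.

End LimitGroup.

Lemma hom_factor (G : groupType) (A B : groupType) (q : UMagmaMorphism.type G A)
    (r : UMagmaMorphism.type G B) :
  range q = setT -> (forall g, q g = 1 -> r g = 1) ->
  exists b : UMagmaMorphism.type A B, forall g, b (q g) = r g.
Proof.
move=> qT qr; have /choice[s sE] a : exists g, q g = a.
  by have : [set: A] a by []; rewrite -qT => -[g _ <-]; exists g.
have rs g h : q g = q h -> r g = r h.
  move=> gh; have : r (g * h^-1) = 1 by apply: qr; rewrite gmulfM gmulfV gh mulgV.
  by rewrite gmulfM gmulfV => /(congr1 (fun z => z * r h)); rewrite mulgVK mul1g.
have bM : {morph (r \o s) : a b / a * b}.
  by move=> a b; rewrite /= -gmulfM; apply: rs; rewrite gmulfM !sE.
by exists (group_hom bM) => g; apply: rs; rewrite sE.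
Qed.

Section ProQuotient.
Variables (C : finGroupType -> Prop) (G : topologicalGroupType) (L : set G).
Hypothesis C_closed : closed_class C.
Hypothesis G_pro : pro C G.
Hypothesis L_subgroup : is_subgroup L.
Hypothesis L_normal : is_normal L.
Hypothesis L_closed : closed L.

(** [K] is the inverse limit of the groups p_i(G)/p_i(L). Closedness of [L] makes the kernel exactly
    [L], and compactness of [G] gives surjectivity. *)
Lemma pro_quotient : exists2 K : topologicalGroupType, pro C K &
  exists f : {continuous_morphism G -> K},
    range f = setT /\ forall g, f g = 1 <-> L g.
Proof.
have [S CS [p pl]] := G_pro.
pose good i (B : {B : finGroupType & UMagmaMorphism.type G B}) :=
  [/\ C (projT1 B), range (projT2 B) = setT &
   forall g, projT2 B g = 1 <-> exists2 l, L l & p i l = p i g].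
have /choice[t tP] i : exists B, good i B.
  have [B CB [q [qT qE]]] := class_quotient C_closed (p i) (CS i) L_subgroup L_normal.
  by exists (existT _ B q).
pose T i := projT1 (t i); pose q i : UMagmaMorphism.type G (T i) := projT2 (t i).
have CT i : C (T i) by case: (tP i).
have qT i : range (q i) = setT by case: (tP i).
have qE i g : q i g = 1 <-> exists2 l, L l & p i l = p i g by case: (tP i).
have qle i j g : idx_le i j -> q j g = 1 -> q i g = 1.
  move=> ij /qE[l Ll lg]; apply/qE; exists l => //.
  by rewrite -!(limit_bond pl _ ij) lg.
(* A bond is demanded for every pair of indices; the trivial homomorphism fills in where the order
   relation fails. *)
have bex ij : exists b : UMagmaMorphism.type (T ij.2) (T ij.1),
    idx_le ij.1 ij.2 -> forall g, b (q ij.2 g) = q ij.1 g.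
  have [le_ij|nle] := pselect (idx_le ij.1 ij.2); last first.
    by exists (@group_hom _ _ (fun=> 1) (fun _ _ => esym (mulg1 1))) => /nle.
  by have [b bE] := hom_factor (qT ij.2) (fun g => @qle _ _ g le_ij); exists b.
pose b i j : UMagmaMorphism.type (T j) (T i) := projT1 (cid (bex (i, j))).
have bE i j g : idx_le i j -> b i j (q j g) = q i g.
  by move=> ij; exact: (projT2 (cid (bex (i, j))) ij).
have qs i x : exists g, q i g = x.
  by have : [set: T i] x by []; rewrite -qT => -[g _ <-]; exists g.
have b_id i x : b i i x = x.
  by have [g <-] := qs i x; apply: bE; exact: idx_refl.
have b_comp i j k : idx_le i j -> idx_le j k ->
    forall x, b i j (b j k x) = b i k x.
  move=> ij jk x; have [g <-] := qs k x; rewrite !bE//.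
  exact: idx_trans jk.
pose S' := InverseSystem (@idx_refl S) (@idx_anti S) (@idx_trans S)
  (@idx_nonempty S) (@idx_directed S) b_id b_comp.
pose K := limit_group S'; have Kl := limit_groupP S'.
have /choice[f fE] g : exists k : K, forall i, limit_proj (S := S') i k = q i g.
  by apply: (limit_ex Kl) => i j; exact: bE.
have fM : {morph f : x y / x * y}.
  by move=> x y; apply: (limit_sep Kl) => i; rewrite gmulfM !fE gmulfM.
have ql i : locally_constant (q i).
  apply: (hom_locally_constant (U := p i @^-1` [set 1])).
  - exact: (limit_locally_constant pl).
  - exact: gmulf1.
  - by move=> g g1; apply/qE; exists 1; [exact: sub1|rewrite gmulf1].
have fc : continuous f.
  apply: (limit_continuous Kl) => i; rewrite (_ : _ \o f = q i)//.
  by apply/funext => g; exact: fE.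
exists K; first by exists S' => //; exists (limit_proj (S := S')).
exists (continuous_hom fM fc); split => [|g]; last first.
  split => /= [f1|Lg]; last first.
    by apply: (limit_sep Kl) => i; rewrite fE gmulf1; apply/qE; exists g.
  apply: contrapT => Lg; have [i iL] := limit_basis pl (closed_openC L_closed) Lg.
  have /qE[l Ll lg] : q i g = 1 by rewrite -fE f1 gmulf1.
  exact: (iL l lg).
apply/seteqP; split => // k _.
(* The fibres of the [q i] over the coordinates of [k] generate a filter on [G]; any cluster point
   of it maps to [k]. *)
pose F := filter_from setT (fun i => [set g | q i g = limit_proj (S := S') i k]).
have FF : ProperFilter F.
  apply: filter_from_proper; last first.
    by move=> i _; have [g gE] := qs i (limit_proj (S := S') i k); exists g.
  apply: filter_from_filter; first by have [i _] := idx_nonempty S; exists i.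
  move=> i j _ _; have [m [im jm]] := idx_directed i j; exists m => // g /= gm.
  split; rewrite /= -(bE _ m)// gm.
    exact: (limit_bond Kl (i := i) (j := m)).
  exact: (limit_bond Kl (i := j) (j := m)).
have [g [_ gF]] := limit_compact pl FF (filterT).
exists g => //; apply: (limit_sep Kl) => i; rewrite fE.
have gi : nbhs g (q i @^-1` [set q i g]).
  by apply: open_nbhs_nbhs; split => //; exact: ql.
by have [h [/= <- <-]] := gF _ _ (ex_intro2 _ _ i I (fun _ => id) : F _) gi.
Qed.

End ProQuotient.

(** * A completion forces properness and a finite outer action *)

Lemma finite_range_factor (T X : Type) (A : finType) (f : T -> X) (r : T -> A) :
  (forall s t, r s = r t -> f s = f t) -> finite_set (range f).
Proof.
move=> fr; have [t0|T0] := pselect (exists t : T, True); last first.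
  by rewrite (_ : range f = set0)//; apply/seteqP; split => // x [t]; case: T0; exists t.
have [t0' _] := t0.
have /choice[h hE] a : exists x, forall t, r t = a -> f t = x.
  have [[t ta]|na] := pselect (exists t, r t = a).
    by exists (f t) => s sa; apply: fr; rewrite sa.
  by exists (f t0') => t ta; case: na; exists t.
apply: (@sub_finite_set _ _ (h @` [set: A])).
  by move=> _ [t _ <-]; exists (r t) => //; rewrite -(hE _ t).
by apply: finite_image; exact: finite_finset.
Qed.

Lemma normal_coreP (G : groupType) (X : subgroup G) x :
  (normal_core X : set G) x <-> forall g, (X : set G) (x ^ g).
Proof.
have -> : (normal_core X : set G) x =
  (\bigcap_(g in [set: G]) [set a ^ g | a in (X : set G)]) x by [].
split=> [Nx g|Xx g _]; last by exists (x ^ g^-1); [exact: Xx|rewrite conjgKV].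
by have [a Xa <-] := Nx g^-1 I; rewrite conjgKV.
Qed.

(** * Monomorphisms of pro-C groups *)

Section ProMono.
Variables (C : finGroupType -> Prop) (G K : topologicalGroupType).
Hypotheses (G_pro : pro C G) (K_pro : pro C K).
Variable f : {continuous_morphism G -> K}.

Lemma pro_compact : compact [set: G].
Proof. by have [S _ [p pl]] := G_pro; exact: limit_compact pl. Qed.

Lemma pro_closed_compact (X : set G) : closed X -> compact X.
Proof. by move=> cX; apply: (subclosed_compact cX pro_compact). Qed.

Lemma pro_compact_closed (X : set K) : compact X -> closed X.
Proof.
by have [S _ [p pl]] := K_pro; apply: compact_closed; exact: limit_hausdorff pl.
Qed.

Lemma pro_image_closed (X : set G) : closed X -> closed (f @` X).
Proof.
move=> cX; apply: pro_compact_closed; apply: compact_image.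
  exact: morphism_continuous.
exact: pro_closed_compact.
Qed.

Lemma open_mono_image (U : set G) : open_mono f -> open U -> open (f @` U).
Proof.
move=> [f_inj fo] oU; rewrite (_ : _ @` _ = range f `&` ~` (f @` (~` U))).
  by apply: openI => //; apply: closed_openC; apply: pro_image_closed; exact: open_closedC.
apply/seteqP; split => [_ [x Ux <-]|_ [[x _ <-] fx]].
  by split; [exists x|case=> y Uy /f_inj yx; apply: Uy; rewrite yx].
by exists x => //; apply: contrapT => Ux; apply: fx; exists x.
Qed.

(** The complement of [U] is compact, so its image is closed, and by injectivity it misses 1; [V] is
    the complement of that image. *)
Lemma mono_nbhs (U : set G) : injective f -> open U -> U 1 ->
  exists V : set K, [/\ open V, V 1 & forall x, V (f x) -> U x].
Proof.
move=> f_inj oU U1; exists (~` (f @` (~` U))); split.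
- by apply: closed_openC; apply: pro_image_closed; exact: open_closedC.
- by case=> x Ux; rewrite -(@gmulf1 _ _ f) => /f_inj x1; apply: Ux; rewrite x1.
- by move=> x fx; apply: contrapT => Ux; apply: fx; exists x.
Qed.

End ProMono.

Section Completion.
Variables (C : finGroupType -> Prop) (H G1 G2 G : topologicalGroupType).
Hypothesis C_closed : closed_class C.
Hypotheses (H_pro : pro C H) (G1_pro : pro C G1) (G2_pro : pro C G2).
Variables (i1 : {continuous_morphism H -> G1}) (i2 : {continuous_morphism H -> G2}).
Hypothesis i_comm : commensuration i1 i2.
Variables (phi1 : {continuous_morphism G1 -> G}) (phi2 : {continuous_morphism G2 -> G}).
Hypothesis G_amalgam : amalgamated_product C i1 i2 phi1 phi2.

Let X0 : subgroup G := range_subgroup (phi1 \o i1).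
Let X : set G := X0.
Let N : set G := normal_core X0.
Let G_pro := amalgam_pro G_amalgam.

Lemma amalgam_range1 h : X (phi1 (i1 h)).
Proof. by exists h. Qed.

Lemma amalgam_range2 h : X (phi2 (i2 h)).
Proof. by exists h => //; exact: (amalgam_comm G_amalgam h). Qed.

Lemma amalgam_range_closed : closed X.
Proof.
have -> : X = phi1 @` (range i1) by rewrite image_comp.
apply: (pro_image_closed G1_pro G_pro).
apply: (pro_image_closed H_pro G1_pro); exact: closedT.
Qed.

(** Conjugating an element of U and X by an element of G1 stays in [U] and in the image of G1, hence
    in [X] by assumption; likewise for G2. By density all of [G] conjugates such elements into
    [X]. *)
Lemma trace_core (U : set G) : is_normal U ->
  (forall x, U (phi1 x) -> X (phi1 x)) ->
  (forall x, U (phi2 x) -> X (phi2 x)) ->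
  forall x, U x -> X x -> N x.
Proof.
move=> nU U1 U2.
have cX := amalgam_range_closed.
(* Both [g] and its inverse are required so that [Y] is visibly closed under inversion. *)
pose Y : set G := [set g | forall x, U x -> X x ->
  X (x ^ g) /\ X (x ^ g^-1)].
have YT : Y = setT.
  apply: (amalgam_dense C_closed G_amalgam).
  - split=> [x Ux Xx|g h Yg Yh x Ux Xx|g Yg x Ux Xx].
    + by rewrite invg1 conjg1.
    + have [Xg Xg'] := Yg x Ux Xx; have [Xh Xh'] := Yh x Ux Xx.
      by rewrite invgM !conjgM; split; [apply: (Yh _ (nU _ g Ux) Xg).1|
         apply: (Yg _ (nU _ h^-1 Ux) Xh').2].
    + by rewrite invgK; have [] := Yg x Ux Xx.
  - rewrite (_ : Y = \bigcap_(x in U `&` X)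
        (((fun g => x ^ g) @^-1` X) `&` ((fun g => x ^ g^-1) @^-1` X))).
      apply: closed_bigI => x _; apply: closedI; apply: closed_preimage => //.
        by apply: continuousJ; [exact: cst_continuous|move=> ?; exact: cvg_id].
      apply: continuousJ; first exact: cst_continuous.
      exact: invg_continuous.
    by apply/seteqP; split => g Yg x; [case; exact: Yg|move=> Ux Xx; exact: Yg].
  - have inX a x : U x -> X x -> X (x ^ phi1 a).
      move=> Ux [h _ /= hx].
      have e : x ^ phi1 a = phi1 (i1 h ^ a) by rewrite -hx; symmetry; exact: gmulfJ.
      by rewrite e; apply: U1; rewrite -e; exact: nU.
    by move=> a x Ux Xx; rewrite -gmulfV; split; exact: inX.
  - have inX a x : U x -> X x -> X (x ^ phi2 a).
      move=> Ux [h _ hx].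
      have {}hx : phi2 (i2 h) = x.
        by rewrite -hx; exact/esym/(amalgam_comm G_amalgam h).
      have e : x ^ phi2 a = phi2 (i2 h ^ a) by rewrite -hx; symmetry; exact: gmulfJ.
      by rewrite e; apply: U2; rewrite -e; exact: nU.
    by move=> a x Ux Xx; rewrite -gmulfV; split; exact: inX.
move=> x Ux Xx; apply/normal_coreP => g.
have : Y g by rewrite YT.
by case/(_ x Ux Xx).
Qed.

Lemma core_sub x : N x -> X x.
Proof. by move=> /normal_coreP/(_ 1); rewrite conjg1. Qed.

Lemma core_subgroup : is_subgroup N. Proof. exact: is_subgroupP. Qed.

Lemma core_normal : is_normal N.
Proof. by move=> x g; exact: normal_coreJ. Qed.

Lemma core_closed : closed N.
Proof.
rewrite (_ : N = \bigcap_g ((fun x => x ^ g) @^-1` X)).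
  apply: closed_bigI => g _; apply: closed_preimage; last exact: amalgam_range_closed.
  by apply: continuousJ; [move=> ?; exact: cvg_id|exact: cst_continuous].
apply/seteqP; split => x; first by move=> /normal_coreP Nx g _; exact: Nx.
by move=> Nx; apply/normal_coreP => g; exact: Nx.
Qed.

Lemma conj_OutP g g' : conj_Out X0 g = conj_Out X0 g' <->
  exists2 y, N y & forall x, N x -> x ^ g = (x ^ g') ^ y.
Proof.
split=> [/out_classP[y gg']|[y Ny gg']].
  exists (val y); first exact: (set_mem (valP y)).
  by move=> x Nx; have /(congr1 val) := gg' (exist _ x (mem_set Nx)).
apply/out_classP; exists (exist _ y (mem_set Ny)) => x.
by apply: val_inj; apply: gg'; exact: (set_mem (valP x)).
Qed.

Lemma completion_proper_finite : has_completion C i1 i2 ->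
  proper_amalgam phi1 phi2 /\ finite_set (range (conj_Out X0)).
Proof.
move=> [K K_pro [j1 [j2 [j1o j2o j12]]]].
have [u [u1 u2 _]] := amalgam_univ G_amalgam K_pro j12.
split.
  by split=> x y xy; [apply: j1o.1; rewrite -!u1|apply: j2o.1; rewrite -!u2]; rewrite /= xy.
have [S _ [p pl]] := K_pro.
have W_open : open (range (j1 \o i1)).
  rewrite -(image_comp i1 j1); apply: (open_mono_image G1_pro K_pro) => //.
  exact: i_comm.1.2.
have W1 : range (j1 \o i1) 1 by exists 1; rewrite //= !gmulf1.
have [i iW] := limit_basis1 pl W_open W1.
have uX_inj x : X x -> u x = 1 -> x = 1.
  case=> h _ <-; rewrite /= -[u _]/((u \o phi1) _) u1 -(@gmulf1 _ _ j1) => /j1o.1 ->.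
  by rewrite gmulf1.
(* [i] is chosen with the kernel of [p i] inside the image of [H] in [K], so [U] meets the images of
   G1 and G2 only inside [X]. *)
pose U : set G := [set x | p i (u x) = 1].
have nU : is_normal U by move=> x g /= x1; rewrite /U /= gmulfJ gmulfJ x1 conj1g.
have UN : forall x, U x -> X x -> N x.
  apply: trace_core => // x; rewrite /U /=.
    rewrite -[u _]/((u \o phi1) _) u1 => /iW[h _ /j1o.1 <-]; exact: amalgam_range1.
  rewrite -[u _]/((u \o phi2) _) u2 => /iW[h _]; rewrite j12 => /j2o.1 <-.
  exact: amalgam_range2.
(* It suffices that the outer class of [g] is determined by its image in the finite group
   [term i]. *)
apply: (@finite_range_factor _ _ _ _ (p i \o u)) => g g' /= gg'.
have k1 : p i (u (g'^-1 * g)) = 1 by rewrite gmulfM gmulfV gmulfM gmulfV gg' mulVg.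
have [h _ hE] := iW _ k1.
pose y := phi1 (i1 h).
have uy : u y = u (g'^-1 * g) by rewrite -hE; exact: u1.
have Ny : N y by apply: UN; [rewrite /U /= uy|exact: amalgam_range1].
apply/conj_OutP; exists y => // x Nx.
pose c := y^-1 * (g'^-1 * g).
have uc : u c = 1.
  have -> : u c = (u y)^-1 * u (g'^-1 * g) by rewrite -gmulfV -gmulfM.
  by rewrite uy mulVg.
pose z := (x ^ g') ^ y; have Nz : N z by do 2 apply: core_normal.
have -> : x ^ g = z ^ c.
  by rewrite /z -!conjgM /c !mulgA mulgK mulgV mul1g.
(* [c] is in the kernel of [u], so this commutator lies both in that kernel and in the normal
   subgroup [N], where [u] is injective. Hence [c] centralizes [z]. *)
have : z^-1 * z ^ c = 1.
  apply: uX_inj; last first.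
    have -> : u (z^-1 * z ^ c) = (u z)^-1 * u z ^ u c.
      by rewrite -gmulfJ -gmulfV -gmulfM.
    by rewrite uc conjg1 mulVg.
  apply: core_sub; apply: (subM core_subgroup); first exact: (subV core_subgroup).
  exact: core_normal.
by move=> /(congr1 (fun t => z * t)) /=; rewrite mulVKg mulg1.
Qed.

End Completion.

(** * Adapted sections *)

Definition centralizer (G : groupType) (N : set G) : set G :=
  [set c | forall x, N x -> x * c = c * x].

Definition mulset (G : groupType) (X Y : set G) : set G :=
  [set z | exists2 x, X x & exists2 y, Y y & z = x * y].

Lemma mulset_closed (C : finGroupType -> Prop) (G : topologicalGroupType)
    (X Y : set G) :
  pro C G -> closed X -> closed Y -> closed (mulset X Y).
Proof.
move=> G_pro cX cY.
have -> : mulset X Y = (fun z : G * G => z.1 * z.2) @` (X `*` Y).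
  apply/seteqP; split => [_ [x Xx [y Yy ->]]|_ [[x y] [Xx Yy] <-]].
    by exists (x, y).
  by exists x => //; exists y.
apply: (pro_compact_closed G_pro); apply: compact_image; first exact: mulg_continuous.
by apply: compact_setX; exact: (pro_closed_compact G_pro).
Qed.

Lemma eq_closed (C : finGroupType -> Prop) (T : topologicalType)
    (G : topologicalGroupType) (f h : T -> G) :
  pro C G -> continuous f -> continuous h -> closed [set x | f x = h x].
Proof.
move=> G_pro fc hc; have -> : [set x | f x = h x] =
    (fun x => (f x)^-1 * h x) @^-1` [set 1].
  apply/seteqP; split => x /=; first by move=> ->; rewrite mulVg.
  by move=> /(congr1 (fun z => f x * z)); rewrite mulVKg mulg1.
apply: closed_preimage; first by apply: continuousM => //; exact: continuousV.
by apply: (pro_compact_closed G_pro); exact: compact_set1.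
Qed.

Lemma centralizer_closed (C : finGroupType -> Prop) (G : topologicalGroupType)
  (N : set G) : pro C G -> closed (centralizer N).
Proof.
move=> G_pro; have -> : centralizer N = \bigcap_(x in N) [set c | x * c = c * x].
  by apply/seteqP; split.
apply: closed_bigI => x _; apply: (eq_closed G_pro).
  by apply: continuousM; [exact: cst_continuous|move=> ?; exact: cvg_id].
by apply: continuousM; [move=> ?; exact: cvg_id|exact: cst_continuous].
Qed.

(** * A finite quotient adapted to the core *)

Section FiniteQuotient.
Variables (C : finGroupType -> Prop) (H G1 G2 G : topologicalGroupType).
Hypothesis C_closed : closed_class C.
Hypotheses (H_pro : pro C H) (G1_pro : pro C G1) (G2_pro : pro C G2).
Variables (i1 : {continuous_morphism H -> G1}) (i2 : {continuous_morphism H -> G2}).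
Hypothesis i_comm : commensuration i1 i2.
Variables (phi1 : {continuous_morphism G1 -> G}) (phi2 : {continuous_morphism G2 -> G}).
Hypothesis G_amalgam : amalgamated_product C i1 i2 phi1 phi2.

Let X0 : subgroup G := range_subgroup (phi1 \o i1).
Let X : set G := X0.
Let N : set G := normal_core X0.
Let G_pro := amalgam_pro G_amalgam.

(** The fibres of the outer action are the left cosets of N C(N), which is closed by compactness.
    Finitely many closed cosets make up its complement. *)
Lemma finite_outer_open : finite_set (range (conj_Out X0)) ->
  open (mulset N (centralizer N)).
Proof.
move=> fin; have cK : closed (mulset N (centralizer N)).
  apply: (mulset_closed G_pro); last exact: (centralizer_closed (C := C)).
  exact: (core_closed H_pro G1_pro G_amalgam).
have gN : is_subgroup N := core_subgroup i1 phi1.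
have nN : is_normal N := @core_normal _ _ _ i1 phi1.
have KP g g' : conj_Out X0 g' = conj_Out X0 g ->
    mulset N (centralizer N) (g^-1 * g').
  move=> /conj_OutP[y Ny yE]; exists y => //.
  exists (y^-1 * (g^-1 * g')); last by rewrite mulVKg.
  move=> x Nx; rewrite conjgC; congr (_ * _); rewrite !conjgM.
  have Nz : N ((x ^ y^-1) ^ g^-1) by do 2 apply: (nN).
  by rewrite yE// conjgKV conjgKV.
have KO g g' : mulset N (centralizer N) (g^-1 * g') -> conj_Out X0 g' = conj_Out X0 g.
  move=> [y Ny [c cc gE]]; apply/conj_OutP; exists y => // x Nx.
  rewrite -conjgM; have -> : g' = g * y * c by rewrite -mulgA -gE mulVKg.
  by rewrite [LHS]conjgM [LHS]conjgE cc ?mulKg//; exact: nN.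
rewrite -closedC.
have -> : ~` mulset N (centralizer N) = 
    \bigcup_(o in range (conj_Out X0) `\ conj_Out X0 1) [set g | conj_Out X0 g = o].
  apply/seteqP; split => [g Kg|g [o [_ o1] go] Kg].
    exists (conj_Out X0 g) => //; split; first by exists g.
    by move=> /= /KP; rewrite invg1 mul1g.
  by apply: o1; rewrite -go /=; apply: KO; rewrite invg1 mul1g.
apply: (@closed_bigcup _ {classic (Out _)}); first exact: finite_setD.
move=> _ [[g _ <-] _].
have -> : [set g' | conj_Out X0 g' = conj_Out X0 g] =
    (fun g' => g^-1 * g') @^-1` mulset N (centralizer N).
  by apply/seteqP; split => g'; [exact: KP|exact: KO].
apply: closed_preimage => //.
by apply: continuousM; [exact: cst_continuous|move=> ?; exact: cvg_id].
Qed.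

(** Let [U] be the kernel of some [p i], small enough to lie in N C(N) and to meet the images of G1
    and G2 inside [X]. Then U and X meet inside [N] by [trace_core], and [Q] is the quotient of [G]
    by U N. *)
Lemma core_finite_quotient :
  proper_amalgam phi1 phi2 -> finite_set (range (conj_Out X0)) ->
  exists2 Q : finGroupType, C Q & exists q : UMagmaMorphism.type G Q,
    [/\ locally_constant q, range q = setT, forall n, N n -> q n = 1,
        (forall a, q (phi1 a) = 1 -> N (phi1 a)) /\
        (forall a, q (phi2 a) = 1 -> N (phi2 a))
      & forall g, q g = 1 -> mulset N (centralizer N) g].
Proof.
move=> [inj1 inj2] /finite_outer_open oK.
have gN : is_subgroup N := core_subgroup i1 phi1.
have nN : is_normal N := @core_normal _ _ _ i1 phi1.
have one_i (K : topologicalGroupType) (i : {continuous_morphism H -> K}) : range i 1.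
  by exists 1; rewrite ?gmulf1.
have [V1 [oV1 V11 V1E]] := mono_nbhs G1_pro G_pro inj1 i_comm.1.2 (one_i _ i1).
have [V2 [oV2 V21 V2E]] := mono_nbhs G2_pro G_pro inj2 i_comm.2.2 (one_i _ i2).
have [S CS [p pl]] := G_pro.
have K1 : mulset N (centralizer N) 1.
  by exists 1; [exact: sub1|exists 1; rewrite ?mulg1// => x _; rewrite mulg1 mul1g].
have [i iV] := limit_basis1 pl (openI (openI oV1 oV2) oK) (conj (conj V11 V21) K1).
pose U : set G := [set g | p i g = 1].
have nU : is_normal U by move=> x g; rewrite /U /= => x1; rewrite gmulfJ x1 conj1g.
have U1 x : U (phi1 x) -> X (phi1 x).
  by move=> /iV[[/V1E [h _ <-] _] _]; exists h.
have U2 x : U (phi2 x) -> X (phi2 x).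
  by move=> /iV[[_ /V2E [h _ <-]] _]; exact: (amalgam_range2 G_amalgam).
have UN := trace_core C_closed H_pro G1_pro G_amalgam nU U1 U2.
have [Q CQ [q [qT qE]]] := class_quotient C_closed (p i) (CS i) gN nN.
have UE l g : p i l = p i g -> U (l^-1 * g).
  by move=> lg; rewrite /U /= gmulfM gmulfV lg mulVg.
exists Q => //; exists q; split => //.
- apply: (hom_locally_constant (U := U)).
  + exact: (limit_locally_constant pl (i := i) [set 1]).
  + exact: gmulf1.
  + by move=> g g1; apply/qE; exists 1; [exact: sub1|rewrite gmulf1].
- by move=> n Nn; apply/qE; exists n.
(* If the element is l u with l in [N] and u in [U], then u is also in the image of G1 (or G2)
   because [N] is; so u is in [X], hence in [N]. *)
- split=> a /qE[l Nl /UE lU]; rewrite -(mulVKg l (_ a)); apply: (subM gN) => //.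
    apply: UN => //; have [h _ hl] := core_sub Nl.
    move: lU; have -> : l^-1 * phi1 a = phi1 ((i1 h)^-1 * a).
      by rewrite -hl gmulfM gmulfV.
    exact: U1.
  apply: UN => //; have [h _ hl] := core_sub Nl.
  move: lU; have -> : l^-1 * phi2 a = phi2 ((i2 h)^-1 * a).
    rewrite -hl gmulfM gmulfV; congr (_^-1 * _); exact: (amalgam_comm G_amalgam).
  exact: U2.
- move=> g /qE[l Nl /UE/iV[_ [y Ny [c cc lE]]]]; exists (l * y).
    exact: (subM gN).
  by exists c => //; rewrite -mulgA -lE mulVKg.
Qed.

End FiniteQuotient.

Definition cong (G : groupType) (N : set G) (x y : G) := N (x * y^-1).

Section Cong.
Variables (G : groupType) (N : set G).
Hypotheses (gN : is_subgroup N) (nN : is_normal N).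

Lemma cong_sym x y : cong N x y -> cong N y x.
Proof. by move=> /(subV gN); rewrite invgM invgK. Qed.
Lemma cong_trans y x z : cong N x y -> cong N y z -> cong N x z.
Proof. by move=> xy yz; have := subM gN xy yz; rewrite mulgA mulgVK. Qed.
Lemma congMr x y z : cong N x y -> cong N (x * z) (y * z).
Proof. by rewrite /cong invgM !mulgA mulgK. Qed.
Lemma congMl x y z : cong N x y -> cong N (z * x) (z * y).
Proof. by move=> xy; have := nN z^-1 xy; rewrite /cong conjgE invgK invgM !mulgA. Qed.
Lemma cong_Ml n x : N n -> cong N (n * x) x.
Proof. by rewrite /cong mulgK. Qed.

End Cong.

Section Sections.
Variables (G : groupType) (Q : finGroupType) (q : UMagmaMorphism.type G Q).
Variable N : set G.
Hypotheses (gN : is_subgroup N) (nN : is_normal N).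
Hypothesis qT : range q = setT.
Hypothesis qN : forall n, N n -> q n = 1.

(** [r] selects a point of each left coset of q(A); it is constant on cosets because [xget] depends
    only on the set [P x]. That set contains [x], so the default 1 of [xget] is never taken. *)
Lemma orbit_rep (A : set G) : is_subgroup A ->
  exists2 r : Q -> Q, (forall x, exists a, A a /\ x = r x * q a) &
    forall x a, A a -> r (x * q a) = r x.
Proof.
move=> gA; pose P x := [set y | exists2 a, A a & x = y * q a].
exists (fun x => xget 1 (P x)) => [x|x a Aa].
  have : P x (xget 1 (P x)).
    by apply: (@xgetPex _ 1); exists x; exists 1; [exact: sub1|rewrite gmulf1 mulg1].
  by case=> a; exists a.
congr (xget 1 _); apply/seteqP; split => y [b Ab bE].
  exists (b * a^-1); first by apply: (subM gA) => //; exact: subV.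
  by rewrite gmulfM gmulfV mulgA -bE mulgK.
by exists (b * a); [exact: subM|rewrite gmulfM mulgA -bE].
Qed.

(** Choose lifts [t] of coset representatives only and extend along each coset of q(A) by elements
    of [A]. The ambiguity is an element of [A] killed by [q], hence lies in [N]. *)
Lemma compatible_section (A : set G) : is_subgroup A ->
  (forall a, A a -> q a = 1 -> N a) ->
  exists2 s : Q -> G, (forall x, q (s x) = x) &
    forall x a, A a -> cong N (s x * a) (s (x * q a)).
Proof.
move=> gA AN; have [r /choice[a aP] rM] := orbit_rep gA.
have aA x : A (a x) by case: (aP x).
have aE x : x = r x * q (a x) by case: (aP x).
have /choice[t tE] x : exists g, q g = x.
  by have : [set: Q] x by []; rewrite -qT => -[g _ <-]; exists g.
exists (fun x => t (r x) * a x) => [x|x b Ab]; first by rewrite gmulfM tE -aE.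
rewrite rM// -mulgA; apply: (congMl nN); apply: AN.
  by apply: (subM gA); [exact: subM|exact: subV].
rewrite gmulfM gmulfV gmulfM; have := aE (x * q b); rewrite rM// {1}(aE x) -mulgA.
by move=> /mulgI ->; rewrite mulgV.
Qed.

(** Compare [s] with a section [s'] compatible with [A]: modulo [N] the discrepancy can be taken in
    C(N), as the kernel of [q] lies in N C(N). Both sections are compatible with [X], so the
    discrepancy at one representative serves, modulo [N], for its whole coset of q(X); this makes
    [d] constant there. *)
Lemma twisted_section (A X : set G) (s : Q -> G) :
  is_subgroup A -> (forall a, A a -> q a = 1 -> N a) ->
  is_subgroup X -> X `<=` A ->
  (forall g, q g = 1 -> mulset N (centralizer N) g) ->
  (forall x, q (s x) = x) ->
  (forall x h, X h -> cong N (s x * h) (s (x * q h))) ->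
  exists d : Q -> G,
    [/\ forall x, q (d x) = 1, forall x, centralizer N (d x),
        forall x h, X h -> d (x * q h) = d x &
        forall x a, A a -> cong N (d x * s x * a) (d (x * q a) * s (x * q a))].
Proof.
move=> gA AN gX XA qM qs sX.
have [s' qs' s'A] := compatible_section gA AN.
have [r /choice[h hP] rM] := orbit_rep gX.
have hX x : X (h x) by case: (hP x).
have hE x : x = r x * q (h x) by case: (hP x).
have /choice[c cP] y : exists c, centralizer N c /\ cong N c (s' y * (s y)^-1).
  have : q (s' y * (s y)^-1) = 1 by rewrite gmulfM gmulfV qs qs' mulgV.
  move=> /qM[n Nn [c cc ->]]; exists c; split => //.
  by apply: (cong_sym gN); exact: cong_Ml.
have qc y : q (c y) = 1.
  have /qN := (cP y).2; rewrite !gmulfM !gmulfV !gmulfM !gmulfV qs qs' mulgV.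
  by rewrite invg1 mulg1.
have ds x : cong N (c (r x) * s x) (s' x).
  have s'x : cong N (s' (r x) * h x) (s' x).
    by have := s'A (r x) (h x) (XA _ (hX x)); rewrite -hE.
  apply: (cong_trans gN) s'x.
  have : cong N (c (r x) * s x) (c (r x) * (s (r x) * h x)).
    apply: (congMl nN); apply: (cong_sym gN).
    by have := sX (r x) (h x) (hX x); rewrite -hE.
  move=> /(cong_trans gN); apply; rewrite mulgA; apply: congMr.
  by have := congMr (s (r x)) (cP (r x)).2; rewrite mulgVK.
exists (c \o r); split=> [x|x|x a Xa|x a Aa] /=.
- exact: qc.
- exact: (cP _).1.
- by rewrite rM.
apply: (cong_trans gN (y := s' x * a)); first by apply: congMr; exact: ds.
apply: (cong_trans gN (y := s' (x * q a))); first exact: s'A.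
by apply: (cong_sym gN); exact: ds.
Qed.

End Sections.

(** * Gluing cocycles *)

(** This is the condition under which sending g to the function x |-> [c x g], paired with [q g], is
    a homomorphism into the wreath product of [G] and [Q]. *)
Definition cocycle (G : groupType) (Q : finGroupType)
    (q : UMagmaMorphism.type G Q) (c : Q -> G -> G) :=
  forall x g h, c x (g * h) = c x g * c (x * q g) h.

Section Cocycles.
Variables (G : groupType) (Q : finGroupType) (q : UMagmaMorphism.type G Q).

Lemma cocycle1 c x : cocycle q c -> c x 1 = 1.
Proof.
move=> /(_ x 1 1); rewrite gmulf1 !mulg1 => /(congr1 (fun z => (c x 1)^-1 * z)).
by rewrite mulVg mulKg.
Qed.

Lemma cocycleV c x g : cocycle q c -> c x g^-1 = (c (x * (q g)^-1) g)^-1.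
Proof.
move=> cc; have := cc x g^-1 g; rewrite mulVg cocycle1// gmulfV => /esym.
by move=> /(congr1 (fun z => z * (c (x * (q g)^-1) g)^-1)); rewrite mulgK mul1g.
Qed.

(* The Kaloujnine-Krasner cocycle of a section [s]. *)
Definition section_cocycle (s : Q -> G) (x : Q) (g : G) : G :=
  s x * g * (s (x * q g))^-1.

Lemma section_cocycleP s : cocycle q (section_cocycle s).
Proof. by move=> x g h; rewrite /section_cocycle gmulfM !mulgA mulgVK. Qed.

End Cocycles.

Section WreathMap.
Variables (A B Q : finGroupType) (b : UMagmaMorphism.type A B).

Definition wreath_map (w : wreath A Q) : wreath B Q := ([ffun x => b (w.1 x)], w.2).

Lemma wreath_mapM : {morph wreath_map : v w / v * w}.
Proof.
move=> v w; rewrite /wreath_map wreathM [RHS]wreathM; congr (_, _).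
by apply/ffunP => x; rewrite !ffunE gmulfM.
Qed.

End WreathMap.

Section CocycleGlue.
Variables (C : finGroupType -> Prop) (H G1 G2 G : topologicalGroupType).
Hypothesis C_closed : closed_class C.
Variables (i1 : {continuous_morphism H -> G1}) (i2 : {continuous_morphism H -> G2}).
Variables (phi1 : {continuous_morphism G1 -> G}) (phi2 : {continuous_morphism G2 -> G}).
Hypothesis G_amalgam : amalgamated_product C i1 i2 phi1 phi2.
Variables (Q : finGroupType) (q : UMagmaMorphism.type G Q).
Hypotheses (CQ : C Q) (ql : locally_constant q).

Lemma section_cocycle_continuous s x : continuous (section_cocycle q s x).
Proof.
apply: continuousM.
  by apply: continuousM; [exact: cst_continuous|move=> ?; exact: cvg_id].
by apply: continuousV; exact: (@locally_constant_continuous _ _ q ql G (fun y => s (x * y))).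
Qed.

(* Pushing the two cocycles down to the finite groups [term i], they become
   homomorphisms into finite wreath products, which lie in [C]; so the universal
   property applies, and the results are compatible in [i]. *)
Lemma cocycle_glue (c1 c2 : Q -> G -> G) :
  cocycle q c1 -> cocycle q c2 ->
  (forall x, continuous (c1 x)) -> (forall x, continuous (c2 x)) ->
  (forall x h, c1 x (phi1 (i1 h)) = c2 x (phi1 (i1 h))) ->
  exists F : Q -> G -> G,
    [/\ cocycle q F, forall x, continuous (F x),
        forall x a, F x (phi1 a) = c1 x (phi1 a) &
        forall x a, F x (phi2 a) = c2 x (phi2 a)].
Proof.
move=> cc1 cc2 ct1 ct2 c12.
have [S CS [p pl]] := amalgam_pro G_amalgam.
pose W (i : idx S) : finGroupType := wreath (term i) Q.
have CW i : C (W i) by exact: class_wreath.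
pose k c i g : W i := ([ffun x => p i (c x g)], q g).
have kM c i : cocycle q c -> {morph k c i : g h / g * h}.
  move=> cc g h; rewrite wreathM /k /= gmulfM; congr (_, _).
  by apply/ffunP => x; rewrite !ffunE cc gmulfM.
have kl c i : (forall x, continuous (c x)) -> locally_constant (k c i).
  move=> ct; apply: locally_constant_pair => //; apply: locally_constant_ffun => x.
  under eq_fun do rewrite ffunE.
  exact: (locally_constant_precomp (limit_locally_constant pl (i := i)) (ct x)).
have uex i : exists u : UMagmaMorphism.type G (W i),
    [/\ locally_constant u, forall a, u (phi1 a) = k c1 i (phi1 a)
      & forall a, u (phi2 a) = k c2 i (phi2 a)].
  pose k1 := @group_hom G (W i) _ (@kM c1 i cc1).
  pose k2 := @group_hom G (W i) _ (@kM c2 i cc2).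
  have [||h|u [ul u1 u2]] :=
    amalgam_fin G_amalgam (k1 := k1 \o phi1) (k2 := k2 \o phi2) (CW i).
  - apply: (locally_constant_precomp (kl c1 i ct1)); exact: morphism_continuous.
  - apply: (locally_constant_precomp (kl c2 i ct2)); exact: morphism_continuous.
  - have e : phi1 (i1 h) = phi2 (i2 h) by exact: (amalgam_comm G_amalgam h).
    rewrite /= -e /k; congr (_, _); apply/ffunP => x; rewrite !ffunE c12 //.
  - by exists u; split.
pose u i := projT1 (cid (uex i)); have uP i := projT2 (cid (uex i)).
have ul i : locally_constant (u i) by case: (uP i).
have u1 i a : u i (phi1 a) = k c1 i (phi1 a) by case: (uP i).
have u2 i a : u i (phi2 a) = k c2 i (phi2 a) by case: (uP i).
(* The glued homomorphisms lie over [q]; this turns multiplicativity of [u i] into the cocycle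
   identity for [q]. *)
have uq i g : (u i g).2 = q g.
  have vM : {morph (fun g => (u i g).2) : g h / g * h}.
    by move=> a b; rewrite gmulfM.
  apply: (amalgam_fin_uniq G_amalgam (u := group_hom vM) (v := q)) => //.
  - exact: (locally_constant_comp (ul i) snd).
  - by move=> a /=; rewrite u1.
  - by move=> a /=; rewrite u2.
have ub i j g x : idx_le i j -> bond i j ((u j g).1 x) = (u i g).1 x.
  move=> ij.
  have vM : {morph (fun g => wreath_map (bond i j) (u j g) : W i) : g h / g * h}.
    by move=> a b; rewrite gmulfM wreath_mapM.
  have vk c a : wreath_map (bond i j) (k c j a) = k c i a.
    by congr (_, _); apply/ffunP => y; rewrite !ffunE (limit_bond pl).
  have /(congr1 (fun w : W i => w.1 x)) : group_hom vM g = u i g.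
    apply: (amalgam_fin_uniq G_amalgam) => //.
    - exact: (locally_constant_comp (ul j)).
    - by move=> a /=; rewrite u1 vk u1.
    - by move=> a /=; rewrite u2 vk u2.
  by rewrite /= ffunE.
have /choice[F FE] xg : exists z, forall i, p i z = (u i xg.2).1 xg.1.
  by apply: (limit_ex pl) => i j; exact: ub.
exists (fun x g => F (x, g)); split.
- move=> x g h; apply: (limit_sep pl) => i.
  by rewrite gmulfM !FE /= gmulfM wreathM ffunE uq.
- move=> x; apply: (limit_continuous pl) => i.
  have -> : p i \o (fun g => F (x, g)) = (fun w : W i => w.1 x) \o u i.
    by apply/funext => g; rewrite /= FE.
  exact: (locally_constant_comp (ul i)).
- by move=> x a; apply: (limit_sep pl) => i; rewrite FE /= u1 ffunE.
- by move=> x a; apply: (limit_sep pl) => i; rewrite FE /= u2 ffunE.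
Qed.

End CocycleGlue.

(** * Finite covers by cosets *)

(** [G] may be nonabelian; as the factors commute pairwise, exchanging adjacent blocks of the
    product generates all permutations. *)
Lemma prodg_perm (G : groupType) (T : eqType) (r1 r2 : seq T) (a : T -> G) :
  (forall x y, commute (a x) (a y)) -> perm_eq r1 r2 ->
  \prod_(x <- r1) a x = \prod_(x <- r2) a x.
Proof.
move=> ac; apply: (@catCA_perm_subst T G (fun r => \prod_(x <- r) a x)) => r s t.
rewrite !big_cat /= !mulgA; congr (_ * _).
by apply: commute_prod => y _; apply: commute_sym; apply: commute_prod => x _.
Qed.

Lemma prodg_reindex (G : groupType) (T : finType) (h : T -> T) (a : T -> G) :
  (forall x y, commute (a x) (a y)) -> injective h ->
  \prod_x a (h x) = \prod_x a x.
Proof.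
move=> ac h_inj; rewrite -(big_map h xpredT a); apply: prodg_perm => //.
apply: uniq_perm; rewrite ?map_inj_uniq ?index_enum_uniq// => x.
rewrite mem_index_enum; apply/mapP; have [g gK hK] := injF_bij h_inj.
by exists (g x); rewrite ?hK ?mem_index_enum.
Qed.

(** Finite index, phrased by a finite family of representatives of left cosets of [Y], without
    forming a coset space. *)
Definition finite_cover (G : groupType) (X Y : set G) (T : finType) (f : T -> G) :=
  forall g, X g -> exists i, Y ((f i)^-1 * g).

(** The element required to lie in [E] is the commutator of [x] and [y]. *)
Definition abelian_mod (G : groupType) (D E : set G) :=
  forall x y, D x -> D y -> E ((y * x)^-1 * (x * y)).

Lemma subX (G : groupType) (X : set G) x n : is_subgroup X -> X x -> X (x ^+ n).
Proof.
move=> gX Xx; elim: n => [|n IHn]; first by rewrite expg0; exact: sub1.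
by rewrite expgS; exact: subM.
Qed.

Lemma sub_mulK (G : groupType) (X : set G) x y :
  is_subgroup X -> X (x^-1 * y) -> X x -> X y.
Proof. by move=> gX Xxy Xx; rewrite -(mulVKg x y); exact: subM. Qed.

Lemma sub_mulgK (G : groupType) (X : set G) x y :
  is_subgroup X -> X (x^-1 * y) -> X y -> X x.
Proof.
by move=> gX /(subV gX); rewrite invgM invgK => Xxy Xy; rewrite -(mulVKg y x); exact: subM.
Qed.

Lemma abelian_modJ (G : groupType) (D E Y : set G) x y :
  is_subgroup Y -> abelian_mod D E -> E `<=` Y -> D x -> D y -> Y x -> Y (x ^ y).
Proof.
move=> gY ab EY Dx Dy Yx.
have -> : x ^ y = x * ((y * x)^-1 * (x * y)).
  by rewrite invgM !mulgA mulgV mul1g conjgE mulgA.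
by apply: (subM gY) => //; apply: EY; exact: ab.
Qed.

Section FinitelyGenerated.
Variables (G : topologicalGroupType) (D R : set G) (n : nat).
Hypotheses (gD : is_subgroup D) (gR : is_subgroup R) (cR : closed R).
Hypotheses (RD : R `<=` D) (n_gt0 : (0 < n)%N).
Hypothesis DR : forall x, D x -> R (x ^+ n).
Hypothesis abDR : abelian_mod D R.

(** Adjoin the elements of [l] one at a time. The new set is the union of the cosets d^e Y, a
    subgroup because [D] is abelian modulo [R]; since d^n lies in [R], exponents below [n] suffice,
    so the union is finite and stays closed. *)
Lemma closed_fg_cover (l : seq G) : (forall x, x \in l -> D x) ->
  exists Y : set G, [/\ is_subgroup Y, closed Y, R `<=` Y /\ Y `<=` D,
    forall x, x \in l -> Y x &
    exists (T : finType) (f : T -> G), finite_cover Y R f].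
Proof.
elim: l => [|d l IHl] lD.
  exists R; split => //; first by split.
  exists unit, (fun=> 1) => g Rg.
  by exists tt; rewrite invg1 mul1g.
have Dd : D d by apply: lD; rewrite mem_head.
have lD' x : x \in l -> D x by move=> xl; apply: lD; rewrite inE xl orbT.
have [Y [gY cY [RY YD] lY [T [f fT]]]] := IHl lD'.
pose Y' : set G := [set z | exists e, Y ((d ^+ e)^-1 * z)].
have dE e : d ^+ e = d ^+ (e %% n) * (d ^+ n) ^+ (e %/ n).
  by rewrite -expgnA -expgnDr mulnC addnC -divn_eq.
have Y'E z : Y' z -> exists2 e, (e < n)%N & Y ((d ^+ e)^-1 * z).
  case=> e Ye; exists (e %% n)%N; first by rewrite ltn_mod.
  have -> : (d ^+ (e %% n))^-1 * z =
      (d ^+ n) ^+ (e %/ n) * ((d ^+ e)^-1 * z).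
    by rewrite [d ^+ e]dE invgM !mulgA mulgV mul1g.
  by apply: (subM gY) => //; apply: (subX _ gY); apply: RY; exact: DR.
have YJ x y : Y x -> D y -> Y (x ^ y).
  by move=> Yx Dy; apply: (abelian_modJ gY abDR RY) => //; exact: YD.
exists Y'; split.
- split=> [|x y [e Ye] [e' Ye']|x [e Ye]].
  + by exists 0%N; rewrite expg0 invg1 mul1g; exact: sub1.
  + exists (e + e')%N; have -> : (d ^+ (e + e'))^-1 * (x * y) =
        ((d ^+ e)^-1 * x) ^ (d ^+ e') * ((d ^+ e')^-1 * y).
      by rewrite expgnDr invgM conjgE !mulgA mulgK.
    by apply: (subM gY) => //; apply: YJ => //; exact: subX.
  (* Modulo [R], d^(e(n-1)) is the inverse of d^e, with a natural number as exponent. *)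
  + exists (e * n.-1)%N.
    have e1 : (d ^+ n) ^+ e = d ^+ (e * n.-1) * d ^+ e.
      by rewrite -expgnA -expgnDr -mulnSr prednK// mulnC.
    have -> : (d ^+ (e * n.-1))^-1 * x^-1 =
        (((d ^+ n) ^+ e)^-1 * ((d ^+ e)^-1 * x)^-1) ^ (d ^+ e)^-1.
      by rewrite e1 conjgE !invgM !invgK !mulgA mulgV mul1g mulgK.
    apply: YJ; last by apply: (subV gD); exact: subX.
    apply: (subM gY); last exact: subV.
    by apply: (subV gY); apply: (subX _ gY); apply: RY; exact: DR.
- have -> : Y' = \bigcup_(e in `I_n) ((fun z => (d ^+ e)^-1 * z) @^-1` Y).
    by apply/seteqP; split => z; [case/Y'E => e en Ye; exists e|case=> e en Ye; exists e].
  apply: closed_bigcup; first exact: finite_II.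
  move=> e _; apply: closed_preimage => //.
  by apply: continuousM; [exact: cst_continuous|move=> ?; exact: cvg_id].
- split=> [x Rx|x [e Ye]]; first by exists 0%N; rewrite expg0 invg1 mul1g; exact: RY.
  by apply: (sub_mulK gD (YD _ Ye)); exact: subX.
- move=> x; rewrite inE => /orP[/eqP->|/lY Yx].
    by exists 1%N; rewrite expg1 mulVg; exact: sub1.
  by exists 0%N; rewrite expg0 invg1 mul1g.
- exists ('I_n * T)%type, (fun u : 'I_n * T => d ^+ u.1 * f u.2).
  move=> z /Y'E[e en /fT[i Ri]].
  by exists (Ordinal en, i); rewrite /= invgM -mulgA.
Qed.

End FinitelyGenerated.

(** The [n]-th power map of [B] has the [n]-torsion as kernel, so the order of the torsion is the
    index of the [n]-th powers, whose cosets are represented by [a]. *)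
Lemma finite_torsion (A : finGroupType) (B : {group A}) (n : nat) (T : finType)
    (a : T -> A) : abelian B ->
  (forall x, x \in B -> exists t, exists2 y, y \in B & x = a t * y ^+ n) ->
  (#|[set x in B | x ^+ n == 1%g]%SET| <= #|T|)%N.
Proof.
move=> abB aB.
have fM : {in B &, {morph (fun x : A => x ^+ n) : x y / x * y}}.
  by move=> x y xB yB; apply: expgMn; exact: (centsP abB).
pose f := Morphism fM.
have fE x : x \in B -> x ^+ n \in (f @* B)%g by move=> xB; exact: (mem_morphim f).
have kerE : [set x in B | x ^+ n == 1%g]%SET = 'ker f.
  by apply/setP => x; rewrite !inE.
have cB : (#|B| <= #|T| * #|(f @* B)%g|)%N.
  rewrite -cardsT -cardsX.
  apply: leq_trans (leq_imset_card (fun u => a u.1 * u.2) _).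
  apply: subset_leq_card; apply/fintype.subsetP => x /aB[t [y yB ->]].
  by apply/imsetP; exists (t, y ^+ n) => //; rewrite finset.in_setX finset.in_setT; exact: fE.
rewrite kerE -(leq_pmul2r (cardG_gt0 (f @* B)%G)).
suff <- : #|B| = (#|'ker f| * #|(f @* B)%g|)%N by [].
by rewrite card_morphim finset.setIid; apply/esym; apply: Lagrange; exact: finset.subsetIl.
Qed.

Section Torsion.
Variables (C : finGroupType -> Prop) (G : topologicalGroupType) (D E : set G).
Hypotheses (G_pro : pro C G) (gD : is_subgroup D) (gE : is_subgroup E).
Hypotheses (ED : E `<=` D) (cE : closed E) (abDE : abelian_mod D E).

(** [O] is the complement of finitely many closed translates of [E] and contains 1, so it contains
    the kernel of some [p i]. *)
Lemma limit_separate (S : inverse_system)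
    (p : forall i : idx S, UMagmaMorphism.type G (term i))
    (pl : is_inverse_limit p) (T : finType) (w : T -> G) :
  (forall t, ~ E (w t)) -> exists i, forall t e, E e -> p i e <> p i (w t).
Proof.
move=> Ew; pose O := ~` \bigcup_(t in [set: T]) ((fun g => w t * g) @^-1` E).
have oO : open O.
  apply: closed_openC; apply: closed_bigcup; first exact: finite_finset.
  move=> t _; apply: closed_preimage => //.
  by apply: continuousM; [exact: cst_continuous|move=> ?; exact: cvg_id].
have [|i iO] := limit_basis1 pl oO.
  by case=> t _; rewrite /preimage /= mulg1; exact: Ew.
exists i => t e Ee pe; apply: (iO ((w t)^-1 * e)).
  by rewrite gmulfM gmulfV pe mulVg.
by exists t => //; rewrite /preimage /= mulVKg.
Qed.

(* A finite abelian group has as many elements killed by [n] as it has cosets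
   modulo [n]-th powers; this passes to the limit. *)
Lemma torsion_cover (n : nat) (T : finType) (f : T -> G) :
  finite_cover D (mulset ((fun y => y ^+ n) @` D) E) f ->
  exists (T' : finType) (f' : T' -> G),
    finite_cover [set y | D y /\ E (y ^+ n)] E f'.
Proof.
move=> fT; apply: contrapT => ncov.
(* Without a finite cover one can choose greedily any number of torsion elements distinct modulo
   [E]; one more than [#|T|] contradicts [finite_torsion] in a suitable finite quotient. *)
have /(_ #|T|.+1)[u [uT uE]] m : exists u : nat -> G,
    (forall j, (j < m)%N -> D (u j) /\ E (u j ^+ n)) /\
    (forall j k, (j < k < m)%N -> ~ E ((u j)^-1 * u k)).
  elim: m => [|m [u [uT uE]]].
    by exists (fun=> 1); split=> // j k; rewrite ltn0 andbF.
  have [y Ty yE] : exists2 y, D y /\ E (y ^+ n) &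
      forall j : 'I_m, ~ E ((u j)^-1 * y).
    apply: contrapT => H; apply: ncov; exists 'I_m, (fun j : 'I_m => u j) => y Ty.
    by apply: contrapT => yE; apply: H; exists y => // j Ej; apply: yE; exists j.
  exists (fun j => if (j < m)%N then u j else y); split=> [j|j k].
    by rewrite ltnS leq_eqVlt => /orP[/eqP->|jm]; rewrite ?ltnn ?jm //; exact: uT.
  move=> /andP[jk]; rewrite ltnS leq_eqVlt => /orP[/eqP km|km].
    by rewrite km ltnn -km jk; rewrite km in jk; exact: (yE (Ordinal jk)).
  by rewrite km (ltn_trans jk km); apply: uE; rewrite jk.
have [S _ [p pl]] := G_pro.
(* Off the pairs j < k, [w] takes a harmless value that is also outside [E]. It uses the indices 0
   and 1, so [T] must be nonempty. *)
pose w (jk : 'I_#|T|.+1 * 'I_#|T|.+1) :=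
  if (jk.1 < jk.2)%N then (u jk.1)^-1 * u jk.2 else (u 0%N)^-1 * u 1%N.
have [T0|T0] := posnP #|T|.
  by have [i _] := fT 1 (sub1 gD); have := card0_eq T0 i; rewrite inE.
have wE jk : ~ E (w jk).
  by rewrite /w; case: ifPn => [jk_lt|_]; apply: uE; rewrite ?jk_lt ?ltn_ord.
have [i iE] := limit_separate pl wE.
have [Di DiP] := fin_subgroup (is_subgroup_image (p i) gD).
have [Ei EiP] := fin_subgroup (is_subgroup_image (p i) gE).
have inD g : D g -> p i g \in Di by move=> Dg; apply/DiP; exists g.
have inEi g : E g -> p i g \in Ei by move=> Eg; apply/EiP; exists g.
have nED : Di \subset 'N(Ei).
  apply/fintype.subsetP => _ /DiP[d Dd <-]; rewrite finset.inE; apply/fintype.subsetP => x.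
  rewrite mem_conjg => /EiP[e Ee eE]; apply/EiP; exists (e ^ d).
    by apply: (abelian_modJ gE abDE) => //; exact: ED.
  by rewrite gmulfJ eE conjgKV.
pose c g := coset Ei (p i g).
have cM g h : D g -> D h -> c (g * h) = c g * c h.
  by move=> Dg Dh; rewrite /c gmulfM morphM// (fintype.subsetP nED)// inD.
have cE1 g : E g -> c g = 1 by move=> Eg; apply: coset_id; exact: inEi.
have cX g k : D g -> c (g ^+ k) = c g ^+ k.
  by move=> Dg; rewrite /c gmulfXn morphX// (fintype.subsetP nED)// inD.
have cV g : D g -> c g^-1 = (c g)^-1.
  by move=> Dg; rewrite /c gmulfV morphV// (fintype.subsetP nED)// inD.
have BP x : x \in (Di / Ei)%g -> exists2 g, D g & x = c g.
  by move=> /morphimP[y _ /DiP[g Dg <-] ->]; exists g.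
have cB g : D g -> c g \in (Di / Ei)%g by move=> Dg; apply: mem_quotient; exact: inD.
have abB : abelian (Di / Ei).
  apply/centsP => _ /BP[x Dx ->] _ /BP[y Dy ->]; rewrite /commute -!cM//.
  have Exy := abDE Dx Dy; have Dyx := subM gD Dy Dx.
  rewrite -[x * y](mulVKg (y * x)) [LHS](cM _ _ Dyx (ED Exy)).
  by rewrite (cE1 _ Exy) mulg1.
have := @finite_torsion _ (Di / Ei)%G n T (c \o f) abB.
apply/not_implyP; split.
  move=> _ /BP[g Dg ->]; have [t [_ [y Dy <-] [e Ee ge]]] := fT g Dg.
  have Dye : D (y ^+ n * e) by apply: (subM gD); [exact: subX|exact: ED].
  have Dft : D (f t) by apply: (sub_mulgK gD _ Dg); rewrite ge.
  exists t, (c y); first exact: cB.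
  rewrite -(mulVKg (f t) g) ge cM// cM; [|exact: subX|exact: ED].
  by rewrite (cE1 e Ee) mulg1 cX.
apply/negP; rewrite -ltnNge.
pose v (j : 'I_#|T|.+1) := c (u j).
have v_inj : injective v.
  have main (j k : 'I_#|T|.+1) : (j < k)%N -> v j <> v k.
    move=> jk vjk; have Dj := (uT j (ltn_ord j)).1; have Dk := (uT k (ltn_ord k)).1.
    have c1 : c ((u j)^-1 * u k) = 1.
      by rewrite cM ?cV//; [rewrite [c (u k)](esym vjk) mulVg|exact: (subV gD)].
    have /(coset_idr _) : coset Ei (p i ((u j)^-1 * u k)) = 1 := c1.
    rewrite (fintype.subsetP nED) => [/(_ isT)/EiP[e Ee pe]|]; last first.
      by apply: inD; apply: (subM gD) => //; exact: (subV gD).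
    by apply: (iE (j, k) e Ee); rewrite /w /= jk.
  move=> j k vjk; apply/val_inj/eqP; rewrite eqn_leq leqNgt [X in _ && X]leqNgt.
  by apply/andP; split; apply/negP => /main; [apply; exact: esym|exact].
rewrite -[X in (X < _)%N]/(#|T|) -ltnS -[X in (X < _.+1)%N](card_ord #|T|.+1) ltnS.
rewrite -(card_imset _ v_inj); apply: subset_leq_card.
apply/fintype.subsetP => _ /imsetP[j _ ->]; have [Dj Ej] := uT j (ltn_ord j).
by rewrite finset.inE cB//= -cX// cE1.
Qed.

End Torsion.

(** * A virtual complement of the core *)

Section Complement.
Variables (C : finGroupType -> Prop) (G : topologicalGroupType).
Hypothesis G_pro : pro C G.
Variables (Q : finGroupType) (q : UMagmaMorphism.type G Q).
Hypothesis ql : locally_constant q.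
Variable N : set G.
Hypotheses (gN : is_subgroup N) (nN : is_normal N) (cN : closed N).
Hypothesis qN : forall n, N n -> q n = 1.
Hypothesis qM : forall g, q g = 1 -> mulset N (centralizer N) g.
Variables A1 A2 : set G.
Hypothesis dense : forall X : set G,
  is_subgroup X -> closed X -> A1 `<=` X -> A2 `<=` X -> X = setT.
Hypothesis NA1 : N `<=` A1.
Variables s d : Q -> G.
Hypothesis qs : forall x, q (s x) = x.
Hypothesis sA1 : forall x a, A1 a -> cong N (s x * a) (s (x * q a)).
Hypothesis qd : forall x, q (d x) = 1.
Hypothesis dN : forall x, centralizer N (d x).
Hypothesis dA2 : forall x a, A2 a ->
  cong N (d x * s x * a) (d (x * q a) * s (x * q a)).
Variable F : Q -> G -> G.
Hypothesis Fc : cocycle q F.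
Hypothesis Ft : forall x, continuous (F x).
Hypothesis FA1 : forall x a, A1 a -> F x a = section_cocycle q s x a.
Hypothesis FA2 : forall x a, A2 a ->
  F x a = section_cocycle q (fun x => d x * s x) x a.

Let Z : set G := N `&` centralizer N.
Let D : set G := [set g | q g = 1] `&` centralizer N.

Lemma centralizer_subgroup : is_subgroup (centralizer N).
Proof.
split=> [x _|c e cc ce x Nx|c cc x Nx]; first by rewrite mulg1 mul1g.
  by rewrite mulgA (cc x Nx) -(mulgA c x) (ce x Nx) mulgA.
by rewrite -[LHS](mulKg c) (mulgA c) -(cc x Nx) mulgK.
Qed.

Lemma centralizer_normal : is_normal (centralizer N).
Proof.
move=> c g cc x Nx; have := cc _ (nN g^-1 Nx).
by move=> /(congr1 (fun z => z ^ g)); rewrite (conjMg (x ^ g^-1) c) (conjMg c) conjgKV.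
Qed.

Let cC : closed (centralizer N) := centralizer_closed (N := N) G_pro.

Let gZ : is_subgroup Z.
Proof. by apply: is_subgroupI; [exact: gN|exact: centralizer_subgroup]. Qed.
Let gD : is_subgroup D.
Proof.
apply: is_subgroupI; last exact: centralizer_subgroup.
exact: (is_subgroup_preimage q (is_subgroup_one Q)).
Qed.
Let nD : is_normal D.
Proof.
move=> x g [/= qx cx]; split; last exact: centralizer_normal.
by rewrite /= gmulfJ qx conj1g.
Qed.
Let cZ : closed Z. Proof. by apply: closedI; [exact: cN|exact: cC]. Qed.
Let cD : closed D.
Proof.
by apply: closedI; [exact: (locally_constant_closed ql (B := [set 1]))|exact: cC].
Qed.
Let ZD : Z `<=` D. Proof. by move=> z [Nz cz]; split => //; exact: qN. Qed.

Let Zcomm x y : Z x -> Z y -> commute x y.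
Proof. by move=> [Nx _] [_ cy]; exact: cy. Qed.

(* The kernel of [q] acts on [N] by inner automorphisms, hence trivially on the
   centre [Z]. *)
Let ZJ z m : Z z -> q m = 1 -> z ^ m = z.
Proof.
move=> [Nz cz] /qM[n Nn [c cc ->]]; rewrite conjgM.
have -> : z ^ n = z by rewrite conjgE -[z * n]cz// mulKg.
by rewrite conjgE cc// mulKg.
Qed.

Let ZJg z g : Z z -> Z (z ^ g).
Proof. by move=> [Nz cz]; split; [exact: nN|exact: centralizer_normal]. Qed.

(** By the cocycle identity, the elements all of whose components lie in [N] form a closed subgroup.
    It contains [A1] and [A2] by the compatibility of the two sections, and density concludes. *)
Lemma glued_in_core x g : N (F x g).
Proof.
pose X : set G := [set g | forall x, N (F x g)].
suff XT : X = setT by have : X g by rewrite XT.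
apply: dense.
- split=> [y|a b Xa Xb y|a Xa y].
  + by rewrite (cocycle1 _ Fc); exact: sub1.
  + by rewrite Fc; exact: subM.
  + by rewrite (cocycleV _ _ Fc); exact: subV.
- have -> : X = \bigcap_y (F y @^-1` N).
    by apply/seteqP; split => a Xa y; [move=> _|]; exact: Xa.
  by apply: closed_bigI => y _; exact: closed_preimage.
- by move=> a Aa y; rewrite FA1//; exact: sA1.
- by move=> a Aa y; rewrite FA2//; exact: dA2.
Qed.

Let FN x n : N n -> F x n = n ^ (s x)^-1.
Proof.
move=> Nn; rewrite FA1; last exact: NA1.
by rewrite /section_cocycle qN// mulg1 conjgE invgK mulgA.
Qed.

Let FM x g h : q g = 1 -> F x (g * h) = F x g * F x h.
Proof. by move=> qg; rewrite Fc qg mulg1. Qed.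

Let FD x e : D e -> Z (F x e).
Proof.
move=> [qe ce]; split=> [|y Ny]; first exact: glued_in_core.
(* Every [y] in [N] is the value of [F x] at [y ^ s x], and [e] commutes with that element of [N];
   multiplicativity of [F x] on the kernel of [q] transfers this to [F x e] and [y]. *)
have Nn : N (y ^ s x) by exact: nN.
have Fn : F x (y ^ s x) = y by rewrite FN// conjgK.
by rewrite -{1}Fn -FM ?qN// ce// FM// Fn.
Qed.

(** On [N], the component [F x] is conjugation by the inverse of [s x]; undoing it makes [E x] the
    identity on [N]. *)
Let E x e := F x e ^ s x.

Let ED x e : D e -> Z (E x e). Proof. by move=> De; apply: ZJg; exact: FD. Qed.
Let EM x e f : D e -> E x (e * f) = E x e * E x f.
Proof. by case=> qe _; rewrite /E FM// conjMg. Qed.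
Let EN x n : N n -> E x n = n.
Proof. by move=> Nn; rewrite /E FN// conjgKV. Qed.
Let E1 x : E x 1 = 1. Proof. by rewrite EN//; exact: sub1. Qed.
Let EV x e : D e -> E x e^-1 = (E x e)^-1.
Proof.
move=> De; have := EM x (e^-1) De; rewrite mulgV E1.
by move=> /(congr1 (fun z => (E x e)^-1 * z)); rewrite mulg1 mulKg.
Qed.
Let EX x e k : D e -> E x (e ^+ k) = E x e ^+ k.
Proof.
move=> De; elim: k => [|k IHk]; first exact: E1.
by rewrite !expgS EM// IHk.
Qed.
Let Et x : continuous (E x).
Proof. by apply: continuousJ => //; exact: cst_continuous. Qed.

(** [G] permutes the components through [q]. In the cocycle expansion [F x g] cancels since [F x e]
    is central in [N], and [s (x * q g)] differs from [s x * g] by an element of the kernel of [q],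
    which acts trivially on [Z]. *)
Let EJ x e g : D e -> E (x * q g) (e ^ g) = E x e ^ g.
Proof.
move=> De; have [qe ce] := De; rewrite /E.
have -> : F (x * q g) (e ^ g) = F x e.
  rewrite conjgE Fc Fc gmulfV mulgK qe mulg1 (cocycleV _ _ Fc) mulgK.
  have [NF cF] := FD x De; by rewrite -cF ?mulKg//; exact: glued_in_core.
rewrite -(conjgM (F x e)).
pose m := (s x * g)^-1 * s (x * q g).
have -> : s (x * q g) = s x * g * m by rewrite /m mulVKg.
rewrite [LHS]conjgM ZJ//; first by apply: ZJg; exact: FD.
by rewrite /m gmulfM gmulfV gmulfM !qs mulVg.
Qed.

(** [n] times the average of the components: equivariant under [G], and the [n]-th power of the
    common value when all components agree. *)
Let psi e := \prod_x E x e.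
Let n := #|Q|.

Let psiD e : D e -> Z (psi e).
Proof.
move=> De; apply: (big_ind Z) => [|x y|x _]; [exact: sub1|exact: subM|exact: ED].
Qed.
Let psiM e f : D e -> D f -> psi (e * f) = psi e * psi f.
Proof.
move=> De Df; rewrite /psi -prodgM_commute => [|x y _ _].
  by apply: eq_bigr => x _; rewrite EM.
by apply: Zcomm; exact: ED.
Qed.
Let psiV e : D e -> psi e^-1 = (psi e)^-1.
Proof.
move=> De; have := psiM De (subV gD De); rewrite mulgV.
have -> : psi 1 = 1 by rewrite /psi big1.
by move=> /(congr1 (fun z => (psi e)^-1 * z)); rewrite mulg1 mulKg.
Qed.
Let psi_const e z : (forall x, E x e = z) -> psi e = z ^+ n.
Proof.
move=> Ez; rewrite /psi (eq_bigr (fun=> z)) => [|x _]; last exact: Ez.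
exact: prodg_const.
Qed.
Let psiJ e g : D e -> psi (e ^ g) = psi e ^ g.
Proof.
move=> De; rewrite /psi conjg_prod.
rewrite -(@prodg_reindex _ _ (fun x => x * q g) (fun x => E x (e ^ g))).
- by apply: eq_bigr => x _; rewrite EJ.
- by move=> x y; apply: Zcomm; apply: ED; exact: nD.
- exact: mulIg.
Qed.
Let psit : continuous psi. Proof. exact: continuous_prod. Qed.

(** The preimage in [D] of the diagonal of Z^Q. It contains [Z], and D/E0 is abelian because it
    embeds in Z^Q modulo the diagonal. *)
Let E0 : set G := [set e | D e /\ forall x, E x e = E 1 e].

Let gE0 : is_subgroup E0.
Proof.
split=> [|e f [De Ee] [Df Ef]|e [De Ee]].
- by split=> [|x]; [exact: sub1|rewrite !E1].
- by split=> [|x]; [exact: subM|rewrite !EM// Ee Ef].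
- by split=> [|x]; [exact: (subV gD)|rewrite !EV// Ee].
Qed.
Let cE0 : closed E0.
Proof.
have -> : E0 = D `&` \bigcap_x [set e | E x e = E 1 e].
  by apply/seteqP; split => e [De Ee]; split => // x; [move=> _; exact: Ee|exact: Ee].
by apply: closedI => //; apply: closed_bigI => x _; exact: (eq_closed G_pro).
Qed.
Let E0D : E0 `<=` D. Proof. by move=> e []. Qed.
Let ZE0 : Z `<=` E0.
Proof. by move=> z Zz; split=> [|x]; [exact: ZD|rewrite !EN//; case: Zz]. Qed.
Let abE0 : abelian_mod D E0.
Proof.
move=> e f De Df; have Dfe := subM gD Df De; have Def := subM gD De Df.
suff E1' x : E x ((f * e)^-1 * (e * f)) = 1.
  split=> [|x]; last by rewrite !E1'.
  by apply: (subM gD) => //; exact: (subV gD).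
rewrite EM; last exact: (subV gD).
rewrite EV// !EM// (Zcomm (ED x De) (ED x Df)) mulVg //.
Qed.

(** The preimage of the [n]-th powers of D/E0. Thus D/R is abelian of exponent dividing [n], as
    [closed_fg_cover] asks, and its finiteness is the input of [torsion_cover]. *)
Let R : set G := mulset ((fun y => y ^+ n) @` D) E0.

Let RE e : R e <-> D e /\ exists2 y, D y & E0 ((y ^+ n)^-1 * e).
Proof.
split=> [[_ [y Dy <-] [u Eu ->]]|[De [y Dy Ey]]].
  split; first by apply: (subM gD); [exact: subX|exact: E0D].
  by exists y => //; rewrite mulKg.
exists (y ^+ n); first by exists y.
by exists ((y ^+ n)^-1 * e) => //; rewrite mulVKg.
Qed.

Let gR : is_subgroup R.
Proof.
have En y e x : D y -> D e -> E x ((y ^+ n)^-1 * e) = (E x y ^+ n)^-1 * E x e.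
  by move=> Dy De; rewrite EM ?EV ?EX//; [exact: subX|apply: (subV gD); exact: subX].
have Dn y e : D y -> D e -> D ((y ^+ n)^-1 * e).
  by move=> Dy De; apply: (subM gD) => //; apply: (subV gD); exact: subX.
split.
- apply/RE; split; first exact: sub1.
  by exists 1; [exact: sub1|rewrite expg1n invg1 mul1g; exact: sub1].
- move=> e f /RE[De [y Dy [_ Ey]]] /RE[Df [z Dz [_ Ez]]].
  have Def := subM gD De Df; have Dyz := subM gD Dy Dz.
  apply/RE; split => //; exists (y * z) => //; split; first exact: Dn.
  have main x : E x (((y * z) ^+ n)^-1 * (e * f)) =
      E x ((y ^+ n)^-1 * e) * E x ((z ^+ n)^-1 * f).
    have [Zy Zz Ze] := And3 (ED x Dy) (ED x Dz) (ED x De).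
    rewrite !En// !EM//.
    move: (E x y) (E x z) (E x e) (E x f) Zy Zz Ze => a b u v Za Zb Zu.
    rewrite expgMn; last exact: Zcomm.
    rewrite invgM !mulgA; congr (_ * _).
    rewrite -[LHS]mulgA; apply: Zcomm; first by apply: (subV gZ); exact: subX.
    by apply: (subM gZ) => //; apply: (subV gZ); exact: subX.
  by move=> x; rewrite !main Ey Ez.
- move=> e /RE[De [y Dy [_ Ey]]]; apply/RE; split; first exact: (subV gD).
  have DV := subV gD Dy; have DeV := subV gD De.
  exists y^-1 => //; split; first exact: Dn.
  have main x : E x ((y^-1 ^+ n)^-1 * e^-1) = (E x ((y ^+ n)^-1 * e))^-1.
    rewrite !En// !EV//; move: (E x y) (E x e) (ED x Dy) (ED x De) => a u Za Zu.
    by rewrite expVgn invgM !invgK; apply: Zcomm; [exact: subX|exact: (subV gZ)].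
  by move=> x; rewrite !main Ey.
Qed.

Let cR : closed R.
Proof.
apply: (mulset_closed G_pro) => //; apply: (pro_compact_closed G_pro).
apply: compact_image; first by apply: continuousX => ?; exact: cvg_id.
exact: (pro_closed_compact G_pro).
Qed.
Let RD : R `<=` D. Proof. by move=> e /RE[]. Qed.
Let E0R : E0 `<=` R.
Proof.
move=> e Ee; apply/RE; split; first exact: E0D.
by exists 1; [exact: sub1|rewrite expg1n invg1 mul1g].
Qed.

(* The cocycle identity makes the set of all [g] whose Schreier elements
   [s x * g * (s (x * q g))^-1] lie in [N * Y] a closed subgroup; it contains
   [A1] and [A2], so [N * Y] is everything in the kernel of [q]. *)
Let D_cover : exists (T : finType) (f : T -> G), finite_cover D R f.
Proof.
have n_gt0 : (0 < n)%N by rewrite /n; apply/card_gt0P; exists 1; rewrite inE.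
have DR e : D e -> R (e ^+ n).
  move=> De; apply/RE; split; first exact: subX.
  by exists e => //; rewrite mulVg; exact: sub1.
have abR : abelian_mod D R by move=> e f De Df; apply: E0R; exact: abE0.
have [l lD|Y [gY cY [RY YD] dY [T [f fT]]]] :=
    closed_fg_cover gD gR cR RD n_gt0 DR abR (l := [seq d x | x <- enum Q]).
  by have /mapP[x _ ->] := lD; split; [exact: qd|exact: dN].
exists T, f => e De; apply: fT; move: e De.
(* For e = m y in [D], with m in [N] and y in [Y], the factor m lies in both [D] and [N], so in [Z],
   which is contained in [Y]. *)
suff NY e : q e = 1 -> mulset N Y e.
  move=> e De; have [m Nm [y Yy ey]] := NY _ De.1.
  have Dm : D m.
    by rewrite -(mulgK y m) -ey; apply: (subM gD) => //; apply: (subV gD); exact: YD.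
  rewrite ey; apply: (subM gY) => //; apply: RY; apply: E0R; apply: ZE0.
  by split => //; exact: Dm.2.
have YC : Y `<=` centralizer N by move=> y /YD[].
have gNY : is_subgroup (mulset N Y).
  split=> [|_ _ [m Nm [y Yy ->]] [m' Nm' [y' Yy' ->]]|_ [m Nm [y Yy ->]]].
  - by exists 1; [exact: sub1|exists 1; [exact: sub1|rewrite mulg1]].
  - exists (m * m'); first exact: subM.
    exists (y * y'); first exact: subM.
    by rewrite -!mulgA (mulgA y) -(YC y Yy m')// -!mulgA.
  - exists m^-1; first exact: subV.
    exists y^-1; first exact: subV.
    by rewrite invgM (YC _ (subV gY Yy))//; exact: subV.
have NNY : N `<=` mulset N Y.
  by move=> m Nm; exists m => //; exists 1; [exact: sub1|rewrite mulg1].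
have YNY : Y `<=` mulset N Y.
  by move=> y Yy; exists 1; [exact: sub1|exists y => //; rewrite mul1g].
pose X : set G := [set g | forall x, mulset N Y (section_cocycle q s x g)].
have XT : X = setT.
  have sc := section_cocycleP q s.
  apply: dense.
  - split=> [y|a b Xa Xb y|a Xa y].
    + by rewrite (cocycle1 _ sc); exact: sub1.
    + by rewrite sc; exact: subM.
    + by rewrite (cocycleV _ _ sc); exact: subV.
  - have -> : X = \bigcap_y (section_cocycle q s y @^-1` mulset N Y).
      by apply/seteqP; split => a Xa y; [move=> _|]; exact: Xa.
    apply: closed_bigI => y _; apply: closed_preimage.
      exact: section_cocycle_continuous.
    exact: (mulset_closed G_pro).
  - by move=> a Aa x; apply: NNY; exact: sA1.
  - move=> a Aa x; have dYx y : Y (d y) by apply: dY; apply/mapP; exists y; rewrite ?mem_enum.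
    (* Passing from the twisted section back to [s] costs only factors from the values of [d], which
       lie in [Y]. *)
    have -> : section_cocycle q s x a =
        (d x)^-1 * section_cocycle q (fun x => d x * s x) x a * d (x * q a).
      by rewrite /section_cocycle invgM !mulgA mulVg mul1g mulgVK.
    apply: (subM gNY); last exact: YNY.
    apply: (subM gNY); first by apply: (subV gNY); exact: YNY.
    by apply: NNY; exact: dA2.
(* An element [e] of the kernel of [q] is itself a Schreier element: that of [e ^ s 1] at the index
   1. *)
move=> qe; have : X (e ^ s 1) by rewrite XT.
move=> /(_ 1); rewrite /section_cocycle gmulfJ qe conj1g mulg1 conjgE.
by rewrite mulVKg mulgK.
Qed.

(** The elements with the same components as y^n psi(y)^-1 for some y in [D]: the image of the
    projection away from the diagonal, times the common kernel of the [E x]. *)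
Let L1 : set G := [set e | D e /\ exists2 y, D y & forall x, E x e * psi y = E x y ^+ n].

Let gL1 : is_subgroup L1.
Proof.
split=> [|e f [De [y Dy Ey]] [Df [z Dz Ez]]|e [De [y Dy Ey]]].
- split; first exact: sub1.
  exists 1; first exact: sub1.
  by move=> x; rewrite E1 expg1n mul1g /psi big1.
- split; first exact: subM.
  exists (y * z); first exact: subM.
  move=> x; have [Zy Zz Zf] := And3 (ED x Dy) (ED x Dz) (ED x Df).
  rewrite !EM// psiM// expgMn; last exact: Zcomm.
  rewrite -Ey -Ez; move: (E x e) (E x f) (psi y) (psi z) Zf (psiD Dy) => a b u v Zb Zu.
  rewrite -!mulgA; congr (_ * _); rewrite !mulgA; congr (_ * _).
  exact: Zcomm.
- split; first exact: (subV gD).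
  exists y^-1; first exact: (subV gD).
  move=> x; rewrite !EV// psiV// expVgn -Ey.
  move: (E x e) (psi y) (ED x De) (psiD Dy) => a u Za Zu; rewrite invgM.
  by apply: Zcomm; exact: (subV gZ).
Qed.

Let nL1 : is_normal L1.
Proof.
move=> e g [De [y Dy Ey]]; split; first exact: nD.
exists (y ^ g); first exact: nD.
move=> x; rewrite -(mulgVK (q g) x) !EJ// psiJ// -conjMg Ey conjXg //.
Qed.

Let cL1 : closed L1.
Proof.
have -> : L1 = fst @` (((fst @^-1` D) `&` (snd @^-1` D)) `&`
    \bigcap_x [set u : G * G | E x u.1 * psi u.2 = E x u.2 ^+ n]).
  apply/seteqP; split => [e [De [y Dy Ey]]|_ [[e y] [[De Dy] Ey] <-]].
    by exists (e, y) => //; split => // x _; exact: Ey.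
  by split => //; exists y => // x; exact: Ey.
have ct1 : continuous (fst : G * G -> G) by move=> ?; exact: cvg_fst.
have ct2 : continuous (snd : G * G -> G) by move=> ?; exact: cvg_snd.
apply: (pro_compact_closed G_pro); apply: compact_image => //.
apply: (@subclosed_compact _ _ [set: G * G]) => //; last first.
  by rewrite -setXTT; apply: compact_setX; exact: (pro_compact G_pro).
apply: closedI; first by apply: closedI; exact: closed_preimage.
apply: closed_bigI => x _; apply: (eq_closed G_pro).
  apply: continuousM.
    exact: (continuous_compose ct1 (@Et x)).
  exact: (continuous_compose ct2 psit).
by apply: continuousX; exact: (continuous_compose ct2 (@Et x)).
Qed.

Lemma virtual_complement : exists L : set G,
  [/\ is_subgroup L, is_normal L, closed L,
      (forall x, L x -> q x = 1) /\ (forall x, L x -> N x -> x = 1) &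
      exists (T : finType) (f : T -> G), finite_cover setT (mulset N L) f].
Proof.
have [T [f fT]] := D_cover.
have [T' [f' f'T]] := torsion_cover G_pro gD gE0 E0D cE0 abE0 fT.
have [S CS [p pl]] := G_pro.
(* These finitely many values exhaust the intersection of [L1] and [N], as shown below; [i] is then
   chosen so that [p i] kills none of them except 1. *)
pose w t := E 1 (f' t) ^+ n * (psi (f' t))^-1.
have [i iw] : exists i, forall t, p i (w t) = 1 -> w t = 1.
  pose O := ~` \bigcup_(t in [set: T']) ([set w t] `&` [set _ | w t <> 1]).
  have oO : open O.
    apply: closed_openC; apply: closed_bigcup; first exact: finite_finset.
    move=> t _; have [wt|wt] := pselect (w t = 1).
      rewrite (_ : _ `&` _ = set0); first exact: closed0.
      by apply/seteqP; split => // x [_ /(_ wt)].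
    rewrite (_ : _ `&` _ = [set w t]); last by apply/seteqP; split => [x []|x ->].
    by apply: (pro_compact_closed G_pro); exact: compact_set1.
  have [|i iO] := limit_basis1 pl oO; first by case=> t _ [/= wt []].
  exists i => t /iO wtO; apply: contrapT => wt; apply: wtO.
  by exists t.
pose L : set G := L1 `&` [set g | p i g = 1].
have gL : is_subgroup L.
  by apply: is_subgroupI => //; exact: (is_subgroup_preimage (p i) (is_subgroup_one _)).
have LD : L `<=` D by move=> g [[]].
exists L; split => //.
- by move=> x g [Lx /= px]; split; [exact: nL1|rewrite /= gmulfJ px conj1g].
- apply: closedI => //.
  exact: (locally_constant_closed (limit_locally_constant pl (i := i)) (B := [set 1])).
- split=> [x /LD[]//|x [[Dx [y Dy Ey]] /= px] Nx].
  have Zx : Z x by split => //; exact: Dx.2.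
  have Ex z : E z x = x by rewrite EN.
  (* As [x] is in [N], all its components equal [x]; so those of y^n all equal x psi(y), and [y] is
     [n]-torsion modulo [E0]. *)
  have E0y : E0 (y ^+ n).
    split; first exact: subX.
    by move=> z; rewrite !EX// -!Ey !Ex.
  have [t [De Ee]] := f'T y (conj Dy E0y).
  set e := _ * y in De Ee.
  have Dft : D (f' t) by apply: (sub_mulgK gD De).
  have ye : y = f' t * e by rewrite /e mulVKg.
  (* The factor [e] has equal components, so its contributions to y^n and to psi(y) cancel and [x]
     depends on [t] alone. *)
  have psie : psi e = E 1 e ^+ n by apply: psi_const.
  have xw : x = w t.
    rewrite /w; have := Ey 1; rewrite Ex ye psiM// EM// expgMn; last by apply: Zcomm; exact: ED.
    rewrite psie mulgA => /mulIg <-; rewrite mulgK//.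
  by rewrite xw; apply: iw; rewrite -xw.
(* The three factors represent [G] modulo the kernel of [q], [D] modulo [R], and [L1] modulo [L].
   For values that [p i] does not take on [L1], [r] defaults to 1. *)
- exists (Q * T * term i)%type.
  have /choice[r rP] (a : term i) : exists r, forall g, L1 g -> p i g = a -> L (r^-1 * g).
    have [[r Lr ra]|nr] := pselect (exists2 r, L1 r & p i r = a).
      exists r => g Lg ga; split; first by apply: (subM gL1) => //; exact: (subV gL1).
      by rewrite /= gmulfM gmulfV ga ra mulVg.
    by exists 1 => g Lg ga; case: nr; exists g.
  exists (fun u => s u.1.1 * f u.1.2 * r u.2) => g _.
  have : q ((s (q g))^-1 * g) = 1 by rewrite gmulfM gmulfV qs mulVg.
  move=> /[dup] q1 /qM[m Nm [c cc gE]].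
  have Dc : D c.
    split => //; rewrite /= -(mulKg m c) -gE gmulfM gmulfV (qN Nm) invg1 mul1g; exact: q1.
  have [t [_ [y Dy <-] [e E0e ce]]] := fT c Dc.
  have [De Ee] := E0e.
  (* Dividing y^n e by this element of [Z] leaves the components E_x(y)^n psi(y)^-1, so that [l]
     falls in [L1] with witness [y]. *)
  pose z := psi y * E 1 e.
  have Zz : Z z by apply: (subM gZ); [exact: psiD|exact: ED].
  pose l := y ^+ n * e * z^-1.
  have L1l : L1 l.
    have Dyn : D (y ^+ n) by exact: subX.
    have Dyne : D (y ^+ n * e) by exact: subM.
    split; first by apply: (subM gD) => //; apply: (subV gD); exact: ZD.
    exists y => // x; rewrite /l (EM x z^-1 Dyne) (EM x e Dyn) (EV x (ZD Zz)).
    rewrite (EN x Zz.1) EX// Ee /z; move: (E x y) (psi y) (E 1 e) => a u v.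
    by rewrite invgM !mulgA mulgK mulgVK.
  exists (q g, t, p i l); rewrite /=.
  have Ll := rP _ l L1l erefl.
  set k := _^-1 * l in Ll.
  pose h := f t * r (p i l).
  (* Here g = s(q g) m h k z. Moving [m] past [h] conjugates it within [N], and [z] commutes with
     [k], which centralizes [N]. *)
  exists (m ^ h * z).
    by apply: (subM gN); [exact: nN|case: Zz].
  exists k => //.
  have lz : l * z = y ^+ n * e by rewrite /l mulgVK.
  have cE : c = h * k * z.
    rewrite -(mulVKg (f t) c) ce -lz /h /k; move: (l) (z) => a b.
    by rewrite !mulgA mulgK.
  have kz : k * z = z * k by have [_ ck] := LD _ Ll; rewrite (ck z Zz.1).
  have -> : s (q g) * f t * r (p i l) = s (q g) * h by rewrite /h mulgA.
  rewrite invgM -mulgA gE cE -(mulgA h k z) kz conjgE.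
  by move: (h) (k) (z) => a b b'; rewrite !mulgA.
Qed.

End Complement.

(** * The completion *)

(** [K] is covered by the finitely many closed cosets f(t_i) f(N). As [N] lies in [A], each of them
    is inside f(A) or disjoint from it, so the complement of f(A) is a finite union of closed
    sets. *)
Lemma finite_cover_image_open (C : finGroupType -> Prop)
    (G K : topologicalGroupType) (f : {continuous_morphism G -> K})
    (A N L : set G) (T : finType) (t : T -> G) :
  pro C G -> pro C K -> range f = setT -> is_subgroup A -> N `<=` A -> closed N ->
  (forall g, L g -> f g = 1) -> finite_cover setT (mulset N L) t ->
  open (f @` A).
Proof.
move=> G_pro K_pro fT gA NA cN fL tT; rewrite -closedC.
have gfA := is_subgroup_image f gA.
have fM x y : f (x * y) = f x * f y by exact: gmulfM.
have -> : ~` (f @` A) = \bigcup_(i in [set i | ~ (f @` A) (f (t i))])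
    (f @` ((fun g => (t i)^-1 * g) @^-1` N)).
  apply/seteqP; split => [k kA|_ [i tiA [g Ng <-]] gA'].
    have [g _ gk] : range f k by rewrite fT.
    have [i [n Nn [l Ll gE]]] := tT g I.
    have kE : k = f (t i) * f n.
      by rewrite -gk -[g](mulVKg (t i)) gE !fM (fL l Ll) mulg1.
    exists i.
      move=> tiA; apply: kA; rewrite kE; apply: (subM gfA) => //.
      by exists n => //; exact: NA.
    by exists (t i * n); rewrite ?fM// /preimage /= mulKg.
  apply: tiA; have := subM gfA gA' (subV gfA (ex_intro2 _ _ _ (NA _ Ng) erefl)).
  by rewrite -gmulfV -gmulfM invgM invgK mulVKg.
apply: closed_bigcup; first exact: finite_finset.
move=> i _; apply: (pro_image_closed G_pro K_pro); apply: closed_preimage => //.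
by apply: continuousM; [exact: cst_continuous|move=> ?; exact: cvg_id].
Qed.

Section Main.
Variables (C : finGroupType -> Prop) (H G1 G2 G : topologicalGroupType).
Hypothesis C_closed : closed_class C.
Hypotheses (H_pro : pro C H) (G1_pro : pro C G1) (G2_pro : pro C G2).
Variables (i1 : {continuous_morphism H -> G1}) (i2 : {continuous_morphism H -> G2}).
Hypothesis i_comm : commensuration i1 i2.
Variables (phi1 : {continuous_morphism G1 -> G}) (phi2 : {continuous_morphism G2 -> G}).
Hypothesis G_amalgam : amalgamated_product C i1 i2 phi1 phi2.

Let X0 : subgroup G := range_subgroup (phi1 \o i1).
Let X : set G := X0.
Let N : set G := normal_core X0.
Let G_pro := amalgam_pro G_amalgam.

Lemma proper_finite_completion :
  proper_amalgam phi1 phi2 -> finite_set (range (conj_Out X0)) ->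
  has_completion C i1 i2.
Proof.
move=> proper fin; have [inj1 inj2] := proper.
have [Q CQ [q [ql qT qN [qN1 qN2] qM]]] :=
  core_finite_quotient C_closed H_pro G1_pro G2_pro i_comm G_amalgam proper fin.
have gN : is_subgroup N := core_subgroup i1 phi1.
have nN : is_normal N := @core_normal _ _ _ i1 phi1.
have cN : closed N := core_closed H_pro G1_pro G_amalgam.
have gX : is_subgroup X := is_subgroupP X0.
have XA1 : X `<=` range phi1 by move=> _ [h _ <-]; exists (i1 h).
have XA2 : X `<=` range phi2.
  by move=> _ [h _ <-]; exists (i2 h) => //; exact/esym/(amalgam_comm G_amalgam).
have NX : N `<=` X by move=> x; exact: core_sub.
have gA1 : is_subgroup (range phi1) by exact: is_subgroup_range.
have gA2 : is_subgroup (range phi2) by exact: is_subgroup_range.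
have qA1 a : range phi1 a -> q a = 1 -> N a by case=> b _ <-; exact: qN1.
have qA2 a : range phi2 a -> q a = 1 -> N a by case=> b _ <-; exact: qN2.
have [s qs sA1] := compatible_section nN qT gA1 qA1.
have sX x h : X h -> cong N (s x * h) (s (x * q h)) by move=> /XA1; exact: sA1.
have [d [qd dN dX dA2]] := twisted_section gN nN qT qN gA2 qA2 gX XA2 qM qs sX.
pose c1 := section_cocycle q s; pose c2 := section_cocycle q (fun x => d x * s x).
(* Since [d] is constant on cosets of q(X), the two cocycles differ on [H] by conjugation by [d x];
   this fixes the values of [c1] there, which lie in [N]. *)
have c12 x h : c1 x (phi1 (i1 h)) = c2 x (phi1 (i1 h)).
  have Xh : X (phi1 (i1 h)) by exists h.
  have Nc : N (c1 x (phi1 (i1 h))) by exact: sX.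
  have -> : c2 x (phi1 (i1 h)) = d x * c1 x (phi1 (i1 h)) * (d x)^-1.
    by rewrite /c2 /section_cocycle dX// invgM !mulgA.
  by rewrite -(dN x _ Nc) mulgK.
have [F [Fc Ft F1 F2]] := cocycle_glue C_closed G_amalgam CQ ql
  (section_cocycleP q s) (section_cocycleP q (fun x => d x * s x))
  (@section_cocycle_continuous _ _ _ ql s)
  (@section_cocycle_continuous _ _ _ ql (fun x => d x * s x)) c12.
have dense (Y : set G) : is_subgroup Y -> closed Y ->
    range phi1 `<=` Y -> range phi2 `<=` Y -> Y = setT.
  move=> gY cY Y1 Y2; apply: (amalgam_dense C_closed G_amalgam) => // g.
    by apply: Y1; exists g.
  by apply: Y2; exists g.
have F1' x a : range phi1 a -> F x a = c1 x a by case=> b _ <-; exact: F1.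
have F2' x a : range phi2 a -> F x a = c2 x a by case=> b _ <-; exact: F2.
have [L [gL nL cL [Lq LN] [T [t tT]]]] := virtual_complement G_pro ql gN nN cN qN
  qM dense (subset_trans NX XA1) qs sA1 qd dN dA2 Fc Ft F1' F2'.
have [K K_pro [k [kT kL]]] := pro_quotient C_closed G_pro gL nL cL.
exists K => //.
have kc := @morphism_continuous _ _ k.
pose j1 := @continuous_hom G1 K (k \o phi1) (@gmulfM _ _ (k \o phi1))
  (continuous_compose (@morphism_continuous _ _ phi1) kc).
pose j2 := @continuous_hom G2 K (k \o phi2) (@gmulfM _ _ (k \o phi2))
  (continuous_compose (@morphism_continuous _ _ phi2) kc).
exists j1, j2; split.
- split.
    (* An element of G1 landing in [L] is killed by [q], hence lies in [N], which meets [L]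
       trivially. *)
    apply: gmulf_inj => a /kL La; apply: inj1; rewrite gmulf1; apply: LN => //.
    by apply: qN1; exact: Lq.
  rewrite (_ : range j1 = k @` range phi1); last by rewrite image_comp.
  apply: (finite_cover_image_open G_pro K_pro kT gA1 _ cN _ tT) => //.
    exact: (subset_trans NX XA1).
  by move=> g /kL.
- split.
    apply: gmulf_inj => a /kL La; apply: inj2; rewrite gmulf1; apply: LN => //.
    by apply: qN2; exact: Lq.
  rewrite (_ : range j2 = k @` range phi2); last by rewrite image_comp.
  apply: (finite_cover_image_open G_pro K_pro kT gA2 _ cN _ tT) => //.
    exact: (subset_trans NX XA2).
  by move=> g /kL.
- by move=> h; exact: (congr1 k (amalgam_comm G_amalgam h)).
Qed.

End Main.

Theorem theorem1 (C : finGroupType -> Prop) (C_closed : closed_class C)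
    (H G1 G2 : topologicalGroupType)
    (H_pro : pro C H) (G1_pro : pro C G1) (G2_pro : pro C G2)
    (i1 : {continuous_morphism H -> G1}) (i2 : {continuous_morphism H -> G2})
    (i_comm : commensuration i1 i2)
    (G : topologicalGroupType)
    (phi1 : {continuous_morphism G1 -> G})
    (phi2 : {continuous_morphism G2 -> G})
    (G_amalgam : amalgamated_product C i1 i2 phi1 phi2) :
  has_completion C i1 i2 <->
  proper_amalgam phi1 phi2 /\
  finite_set (range (conj_Out (range_subgroup (phi1 \o i1)))).
Proof.
split; first exact: (completion_proper_finite C_closed H_pro G1_pro i_comm G_amalgam).
by case; exact: (proper_finite_completion C_closed H_pro G1_pro G2_pro i_comm G_amalgam).
Qed.
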